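(* Let $A$ be a Buchsbaum local ring with maximal ideal $\mathfrak{m}$ and $d = \dim A \geq 1$. Let $x_1, x_2, \dots, x_d$ be a system of parameters for $A$ and put $Q = (x_1^{n_1}, x_2^{n_2}, \dots, x_d^{n_d})$ with integers $n_i \geq 1$ $(1 \leq i \leq d)$. Let $I = Q : \mathfrak{m}$. Then $I^2 = QI$ if $\mathrm{e}(A) > 1$ and $n_i \geq 2$ for some $1 \leq i \leq d$.
   Context: A Noetherian local ring $A$ with maximal ideal $\mathfrak{m}$ and $d = \dim A\geq 1$ is a Buchsbaum ring if the difference $\ell_A(A/Q) - \mathrm{e}^0_Q(A)$ is independent of the choice of a parameter ideal $Q$ (an ideal generated by a system of parameters), where $\mathrm{e}^0_Q(A)$ is the multiplicity of $A$ with respect to $Q$; equivalently, every system of parameters $x_1,\dots,x_d$ satisfies $(x_1,\dots,x_{i-1}):x_i = (x_1,\dots,x_{i-1}):\mathfrak{m}$ for all $1\leq i\leq d$. $\mathrm{e}(A) = \mathrm{e}^0_{\mathfrak{m}}(A)$ is the multiplicity of $A$ with respect to $\mathfrak{m}$. $Q:\mathfrak{m} = \{x\in A \mid x\mathfrak{m}\subseteq Q\}$. *)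

(* Defs.v *)
From HB Require Import structures.
From mathcomp Require Import all_boot all_order all_algebra.
From mathcomp Require Import boolp classical_sets.

Set Implicit Arguments.
Unset Strict Implicit.
Unset Printing Implicit Defensive.
Import Order.TTheory GRing.Theory Num.Theory.
Local Open Scope classical_set_scope.
Local Open Scope ring_scope.

Section IdealTheory.
Variable A : comNzRingType.
Implicit Types (I J Q m P : set A) (S : set A).

(* The unit ideal is allowed, unlike for [idealr] of ring_quotient.v. *)
Definition is_ideal I : Prop :=
  [/\ I 0, (forall a b, I a -> I b -> I (a + b))
    & (forall r a, I a -> I (r * a))].

Definition ideal_span S : set A :=
  [set a | forall J, is_ideal J -> S `<=` J -> J a].

Definition ideal_mul I J : set A :=
  ideal_span [set a * b | a in I & b in J].

Definition ideal_exp I (k : nat) : set A := iter k (ideal_mul I) setT.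

Definition ideal_colon I J : set A :=
  [set a | forall b, J b -> I (a * b)].

Definition ideal_radical I : set A := [set a | exists k : nat, I (a ^+ k)].

Definition prime_ideal P : Prop :=
  [/\ is_ideal P, ~ P 1 & forall a b, P (a * b) -> P a \/ P b].

Definition maximal_ideal m : Prop :=
  [/\ is_ideal m, ~ m 1
    & forall J, is_ideal J -> ~ J 1 -> m `<=` J -> J = m].

Definition noetherian_ring : Prop :=
  forall I, is_ideal I -> exists s : seq A, I = ideal_span [set` s].

Definition local_ring m : Prop :=
  maximal_ideal m /\ forall m', maximal_ideal m' -> m' = m.

Definition has_chain (C : set (set A)) (k : nat) : Prop :=
  exists P : nat -> set A,
    (forall i, (i <= k)%N -> C (P i)) /\
    (forall i, (i < k)%N -> P i `<` P i.+1).

(* Largest k such that C contains a chain P_0 < ... < P_k.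
   Junk value 0 when C is empty or has arbitrarily long chains. *)
Definition max_chain (C : set (set A)) : nat :=
  xget 0%N [set k | has_chain C k /\ forall j, has_chain C j -> (j <= k)%N].

Definition krull_dim : nat := max_chain prime_ideal.

(* Length of the A-module A/J, for an ideal J: the submodules of A/J
   correspond to the ideals containing J. *)
Definition quotient_length J : nat :=
  max_chain [set I | is_ideal I /\ J `<=` I].

(* e 0, ..., e d are the Hilbert coefficients of J, where d = dim A:
   l(A/J^(k+1)) = sum_(0 <= i <= d) (-1)^i e_i binom(k+d-i, d-i) for k >> 0. *)
Definition hilbert_coefs J (e : nat -> int) : Prop :=
  let d := krull_dim in
  exists N : nat, forall k, (N <= k)%N ->
    (quotient_length (ideal_exp J k.+1))%:Z =
      \sum_(i < d.+1) (-1) ^+ i * e i * ('C(k + d - i, d - i))%:Z.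

(* Junk value 0 when there is no Hilbert polynomial of degree at most dim A;
   it exists whenever A is Noetherian local and J is primary to its
   maximal ideal. *)
Definition multiplicity J : int :=
  xget 0 [set c | exists e : nat -> int, hilbert_coefs J e /\ e 0%N = c].

(* For a maximal ideal m, an ideal is m-primary iff its radical is m. *)
Definition system_of_parameters m d (x : 'I_d -> A) : Prop :=
  d = krull_dim /\ ideal_radical (ideal_span (range x)) = m.

Definition parameter_ideal m Q : Prop :=
  exists d (x : 'I_d -> A),
    system_of_parameters m x /\ Q = ideal_span (range x).

(* Requiring 1 <= krull_dim also excludes its junk value. *)
Definition buchsbaum_local_ring m : Prop :=
  [/\ noetherian_ring, local_ring m, (1 <= krull_dim)%N
    & forall Q Q', parameter_ideal m Q -> parameter_ideal m Q' ->
        (quotient_length Q)%:Z - multiplicity Q =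
        (quotient_length Q')%:Z - multiplicity Q'].

End IdealTheory.

Arguments noetherian_ring : clear implicits.
Arguments krull_dim : clear implicits.

(* Main.v *)
Require Import Defs.
From HB Require Import structures.
From mathcomp Require Import all_boot all_order all_algebra.
From mathcomp Require Import boolp classical_sets.
From mathcomp Require Import ring zify.

Set Implicit Arguments.
Unset Strict Implicit.
Unset Printing Implicit Defensive.
Import Order.TTheory GRing.Theory Num.Theory.
Local Open Scope classical_set_scope.
Local Open Scope ring_scope.

(** Let c be the constant value of l(A/Q) - e(Q) on parameter ideals Q.  For a
    system of parameters x, the lengths of A modulo the ideals of powers
    (x_1^(n_1), ..., x_d^(n_d)) are concave in each n_i.  Subtracting c turns them
    into multiplicities, which are homogeneous of degree d in n; this forces
    e(J, x_i^k) = k e(J, x_i), where J is generated by the x_j with j <> i.  Hence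
    the length of A modulo (x_i) + (J : x_i^k) is e(J, x_i) for all k >= 1, which
    gives J : x_i^k = J : x_i = J : m, and e(A) <= 1 as soon as m is contained in
    (x_i) + (J : m).

    Assume now e(A) > 1, put x = x_i, N = n_i >= 2, let J be generated by the
    x_j^(n_j) with j <> i, and W = J : m.  Then mI = mQ, every element of I has
    the form x^(N-1) a + w with w in W and a m contained in x m + W, and each of
    the resulting products is written as a combination of the generators of Q
    whose coefficients are multiplied into Q by m.

    The Hilbert-Samuel function of Q is a polynomial because the colengths of the
    initial ideals at the monomials in x_1, ..., x_d form an antitone function of
    the exponent. *)

(** * Ideals and length *)

Section Ideals.
Variable A : comNzRingType.
Implicit Types (I J K : set A) (a r x y z : A).

Lemma ideal0 J : is_ideal J -> J 0.
Proof. by case. Qed.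

Lemma idealD J a b : is_ideal J -> J a -> J b -> J (a + b).
Proof. by case=> _ h _; exact: h. Qed.

Lemma ideal_mull J r a : is_ideal J -> J a -> J (r * a).
Proof. by case=> _ _ h; exact: h. Qed.

Lemma ideal_mulr J r a : is_ideal J -> J a -> J (a * r).
Proof. by rewrite mulrC; exact: ideal_mull. Qed.

Lemma idealN J a : is_ideal J -> J a -> J (- a).
Proof. by move=> iJ Ja; rewrite -mulN1r; exact: ideal_mull. Qed.

Lemma idealB J a b : is_ideal J -> J a -> J b -> J (a - b).
Proof. by move=> iJ Ja Jb; apply: idealD => //; exact: idealN. Qed.

Lemma idealBP J a b : is_ideal J -> J (a - b) -> J b -> J a.
Proof. by move=> iJ Jab Jb; rewrite -[a](subrK b); exact: idealD. Qed.

Lemma ideal_sum J (T : Type) (s : seq T) (P : pred T) (F : T -> A) :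
  is_ideal J -> (forall i, P i -> J (F i)) -> J (\sum_(i <- s | P i) F i).
Proof.
move=> iJ h; elim/big_ind: _ => //; first exact: ideal0.
by move=> *; exact: idealD.
Qed.

Lemma is_idealT : is_ideal [set: A]. Proof. by []. Qed.

Lemma ideal1 J : is_ideal J -> J 1 -> J = setT.
Proof.
by move=> iJ J1; apply/seteqP; split=> // a _; rewrite -[a]mulr1; exact: ideal_mull.
Qed.

Lemma is_ideal_span (S : set A) : is_ideal (ideal_span S).
Proof.
split=> [J iJ _|a b ha hb J iJ SJ|r a ha J iJ SJ]; first exact: ideal0.
- by apply: idealD => //; [exact: ha|exact: hb].
- by apply: ideal_mull => //; exact: ha.
Qed.

Lemma sub_ideal_span (S : set A) : S `<=` ideal_span S.
Proof. by move=> a Sa J _; exact. Qed.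

Lemma ideal_spanS (S : set A) J : is_ideal J -> S `<=` J -> ideal_span S `<=` J.
Proof. by move=> iJ SJ a; exact. Qed.

Lemma ideal_mul_in I J a b : I a -> J b -> ideal_mul I J (a * b).
Proof. by move=> Ia Jb; apply: sub_ideal_span; exists a => //; exists b. Qed.

Lemma ideal_mul_sub I J K : is_ideal K ->
  (forall a b, I a -> J b -> K (a * b)) -> ideal_mul I J `<=` K.
Proof. by move=> iK h; apply: ideal_spanS => // _ [a Ia [b Jb <-]]; exact: h. Qed.

Lemma ideal_mulS I I' J J' :
  I `<=` I' -> J `<=` J' -> ideal_mul I J `<=` ideal_mul I' J'.
Proof.
move=> hI hJ; apply: ideal_mul_sub; first exact: is_ideal_span.
by move=> a b /hI Ia /hJ Jb; exact: ideal_mul_in.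
Qed.

Lemma is_ideal_exp I k : is_ideal (ideal_exp I k).
Proof. by case: k => [|k]; [exact: is_idealT|exact: is_ideal_span]. Qed.

Lemma ideal_expS I J k : I `<=` J -> ideal_exp I k `<=` ideal_exp J k.
Proof. by move=> IJ; elim: k => // k IH; exact: ideal_mulS. Qed.

Lemma is_ideal_colon I J : is_ideal I -> is_ideal (ideal_colon I J).
Proof.
move=> iI; split=> [b _|a b ha hb c Jc|r a ha c Jc].
- by rewrite mul0r; exact: ideal0.
- by rewrite mulrDl; apply: idealD => //; [exact: ha|exact: hb].
- by rewrite -mulrA; apply: ideal_mull => //; exact: ha.
Qed.

(** [addp J x] is J + xA and [colp J x] is J : x, given by explicit conditions so that elements can
    be computed with directly. *)
Definition addp J x : set A := [set a | exists r, J (a - r * x)].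
Definition colp J x : set A := [set a | J (a * x)].

Lemma is_ideal_addp J x : is_ideal J -> is_ideal (addp J x).
Proof.
move=> iJ; split.
- by exists 0; rewrite mul0r subr0; exact: ideal0.
- move=> a b [r hr] [s hs]; exists (r + s).
  have -> : a + b - (r + s) * x = (a - r * x) + (b - s * x) by ring.
  exact: idealD.
- move=> r a [s hs]; exists (r * s).
  have -> : r * a - r * s * x = r * (a - s * x) by ring.
  exact: ideal_mull.
Qed.

Lemma is_ideal_colp J x : is_ideal J -> is_ideal (colp J x).
Proof.
move=> iJ; split; rewrite /colp /=.
- by rewrite mul0r; exact: ideal0.
- by move=> a b Ja Jb; rewrite mulrDl; exact: idealD.
- by move=> r a Ja; rewrite -mulrA; exact: ideal_mull.
Qed.

Lemma addp_sub J x : J `<=` addp J x.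
Proof. by move=> a Ja; exists 0; rewrite mul0r subr0. Qed.

Lemma addp_gen J x r : is_ideal J -> addp J x (r * x).
Proof. by move=> iJ; exists r; rewrite subrr; exact: ideal0. Qed.

Lemma addp_id J x : is_ideal J -> addp J x x.
Proof. by move=> iJ; rewrite -{2}[x]mul1r; exact: addp_gen. Qed.

Lemma addp_min J K x : is_ideal K -> J `<=` K -> K x -> addp J x `<=` K.
Proof.
by move=> iK JK Kx a [r /JK h]; apply: (idealBP iK h); exact: ideal_mull.
Qed.

Lemma addpS J K x : J `<=` K -> addp J x `<=` addp K x.
Proof. by move=> JK a [r /JK h]; exists r. Qed.

Lemma colpS J K x : J `<=` K -> colp J x `<=` colp K x.
Proof. by move=> JK a; exact: JK. Qed.

Lemma colp_sub J x : is_ideal J -> J `<=` colp J x.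
Proof. by move=> iJ a Ja; exact: ideal_mulr. Qed.

Lemma colp_exp_le J x k l : is_ideal J -> (k <= l)%N ->
  colp J (x ^+ k) `<=` colp J (x ^+ l).
Proof.
move=> iJ kl a; rewrite /colp /= => h.
by rewrite -(subnK kl) exprD mulrCA; exact: ideal_mull.
Qed.

(** Modulo J an element a of K is some r x. As J lies in K, so does r x; hence r is in K : x, thus
    in J : x, and a is in J. *)
Lemma addp_addp_colp_eq J K x : is_ideal J -> is_ideal K -> J `<=` K ->
  addp K x `<=` addp J x -> colp K x `<=` colp J x -> K `<=` J.
Proof.
move=> iJ iK JK hadd hcol a Ka.
have [r hr] : addp J x a by apply: hadd; exact: addp_sub.
apply: (idealBP iJ hr); apply: hcol; rewrite /colp /=.
have -> : r * x = a - (a - r * x) by ring.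
by apply: idealB => //; exact: JK.
Qed.

Section Length.

Definition over J : set (set A) := [set I | is_ideal I /\ J `<=` I].

(** Indexing a chain by its last ideal makes extension at the top and concatenation simple
    inductions. *)
Inductive chain_to J : set A -> nat -> Prop :=
| chain_to0 K of is_ideal K & J `<=` K : chain_to J K 0
| chain_toS K K' k of chain_to J K k & is_ideal K' & K `<` K' :
    chain_to J K' k.+1.

Lemma chain_to_over J K k : chain_to J K k -> is_ideal K /\ J `<=` K.
Proof.
elim=> {K k} [//|K K' k _ [_ JK] iK' [KK' _]]; split=> //.
exact: subset_trans KK'.
Qed.

Lemma has_chainP J k : has_chain (over J) k <-> exists K, chain_to J K k.
Proof.
split=> [[P [hP hlt]]|[K hK]].
  suff h i : (i <= k)%N -> chain_to J (P i) i by exists (P k); exact: h.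
  elim: i => [_|i IH ik]; first by have [iP JP] := hP 0%N isT; exact: chain_to0.
  apply: (chain_toS (IH (ltnW ik))); last exact: hlt.
  by have [] := hP _ ik.
suff [P [h1 h2 _]] : exists P : nat -> set A,
    [/\ forall i, (i <= k)%N -> over J (P i),
        forall i, (i < k)%N -> P i `<` P i.+1 & P k = K] by exists P.
elim: hK => {K k} [K iK JK|K K' k cK [P [h1 h2 h3]] iK' KK'].
  by exists (fun=> K); split=> // i; rewrite leqn0.
exists (fun i => if (i <= k)%N then P i else K'); split=> [i _|i|].
- have [ik|_] := leqP i k; first exact: h1.
  have [_ JK] := chain_to_over cK.
  by split=> //; exact: subset_trans JK (proj1 KK').
- rewrite ltnS => ik; rewrite ik; have [ltik|leki] := ltnP i k; first exact: h2.
  by have -> : i = k by [apply/eqP; rewrite eqn_leq ik]; rewrite h3.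
- by rewrite ltnn.
Qed.

Definition has_length J k :=
  has_chain (over J) k /\ forall j, has_chain (over J) j -> (j <= k)%N.

Lemma has_length_uniq J k l : has_length J k -> has_length J l -> k = l.
Proof.
by move=> [ck hk] [cl hl]; apply/eqP; rewrite eqn_leq hl // hk.
Qed.

Lemma quotient_lengthE J k : has_length J k -> quotient_length J = k.
Proof.
move=> h; apply: xget_unique => // l [cl hl]; exact: has_length_uniq h.
Qed.

Definition finite_length J := exists k, has_length J k.

Lemma finite_lengthP J : finite_length J -> has_length J (quotient_length J).
Proof. by case=> k h; rewrite (quotient_lengthE h). Qed.

Lemma chain_to_top J K K' k : chain_to J K k -> is_ideal K' -> K `<=` K' ->
  chain_to J K' k.
Proof.
case=> {K k} [K _ JK|K0 K k cK iK KK] iK' KK'.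
  by apply: chain_to0 => //; exact: subset_trans KK'.
apply: (chain_toS cK) => //; split; first exact: subset_trans (proj1 KK) KK'.
by move=> h; apply: (proj2 KK); exact: subset_trans KK' h.
Qed.

Lemma chain_to_cat J J' K K' k l : chain_to J K k -> chain_to J' K' l ->
  K `<=` J' -> chain_to J K' (l + k).
Proof.
move=> cK; elim=> {K' l} [K' iK' JK' KJ|L K' l _ IH iK' LK' KJ].
  by apply: chain_to_top cK iK' _; exact: subset_trans JK'.
by apply: chain_toS (IH KJ) iK' LK'.
Qed.

(** The map L -> J + xL carries chains above J : x to chains above J. It stays strict: if r x = s x
    modulo J with s in K, then r - s lies in J : x, hence in K. *)
Lemma chain_to_colp J x K k : is_ideal J -> chain_to (colp J x) K k ->
  chain_to J [set z | exists2 r, K r & J (z - r * x)] k.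
Proof.
move=> iJ.
have iL L : is_ideal L -> is_ideal [set z | exists2 r, L r & J (z - r * x)].
  move=> iL; split.
  - by exists 0; rewrite ?mul0r ?subr0; exact: ideal0.
  - move=> a b [r Lr hr] [s Ls hs]; exists (r + s); first exact: idealD.
    have -> : a + b - (r + s) * x = (a - r * x) + (b - s * x) by ring.
    exact: idealD.
  - move=> r a [s Ls hs]; exists (r * s); first exact: ideal_mull.
    have -> : r * a - r * s * x = r * (a - s * x) by ring.
    exact: ideal_mull.
elim=> {K k} [K iK JK|K K' k cK IH iK' [KK' nKK']].
  apply: chain_to0; first exact: iL.
  by move=> a Ja; exists 0; rewrite ?mul0r ?subr0 //; exact: ideal0.
apply: (chain_toS IH); first exact: iL.
have [iK colK] := chain_to_over cK.
split=> [z [r /KK' Kr h]|h]; first by exists r.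
apply: nKK' => r K'r.
have [|s Ks hs] := h (r * x); first by exists r => //; rewrite subrr; exact: ideal0.
by apply: (idealBP iK (colK (r - s) _) Ks); rewrite /colp /= mulrBl.
Qed.

(** By [addp_addp_colp_eq] a strict step from K to K' stays strict after adding xA or after taking
    the colon by x, so s or t grows with k. *)
Lemma chain_to_split J x K k : is_ideal J -> chain_to J K k ->
  exists s t, [/\ chain_to (addp J x) (addp K x) s,
                  chain_to (colp J x) (colp K x) t & (k <= s + t)%N].
Proof.
move=> iJ; elim=> {K k} [K iK JK|K K' k cK [s [t [cs ct kst]]] iK' KK'].
  exists 0%N, 0%N; split=> //; apply: chain_to0.
  - exact: is_ideal_addp.
  - exact: addpS.
  - exact: is_ideal_colp.
  - exact: colpS.
have [iK _] := chain_to_over cK; have [sK nK] := KK'.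
have [hadd|hadd] := EM (addp K' x `<=` addp K x); last first.
  exists s.+1, t; split=> //.
    by apply: (chain_toS cs); [exact: is_ideal_addp|split=> //; exact: addpS].
  by apply: chain_to_top ct _ _; [exact: is_ideal_colp|exact: colpS].
have [hcol|hcol] := EM (colp K' x `<=` colp K x).
  by case: nK; exact: addp_addp_colp_eq hcol.
exists s, t.+1; split=> //.
- by apply: chain_to_top cs _ _; [exact: is_ideal_addp|exact: addpS].
- by apply: (chain_toS ct); [exact: is_ideal_colp|split=> //; exact: colpS].
- by rewrite addnS ltnS.
Qed.

(* A/(J : x) is isomorphic to (J + xA)/J. *)
Lemma has_length_addp J x k l : is_ideal J ->
  has_length (addp J x) k -> has_length (colp J x) l -> has_length J (k + l).
Proof.
move=> iJ [/has_chainP [P cP] hk] [/has_chainP [R cR] hl]; split.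
  apply/has_chainP; exists P; apply: chain_to_cat (chain_to_colp iJ cR) cP _.
  by move=> z [r _ h]; exists r.
move=> j /has_chainP [K cK].
have [s [t [cs ct jst]]] := chain_to_split x iJ cK.
apply: (leq_trans jst); apply: leq_add; [apply: hk|apply: hl];
  by apply/has_chainP; eexists; eassumption.
Qed.

(** For the equality case: if I is strictly larger than J, a longest chain above I can be prolonged
    by J at the bottom. *)
Lemma has_length_sub J I k : is_ideal J -> is_ideal I -> J `<=` I ->
  has_length J k ->
  exists l, [/\ has_length I l, (l <= k)%N & l = k -> I `<=` J].
Proof.
move=> iJ iI JI [_ hk].
have sub j : has_chain (over I) j -> has_chain (over J) j.
  move=> [P [h1 h2]]; exists P; split=> // i ik; have [iP IP] := h1 i ik.
  by split=> //; exact: subset_trans IP.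
pose p := fun j => `[< has_chain (over I) j >].
have p0 : exists j, p j.
  by exists 0%N; apply/asboolP/has_chainP; exists I; exact: chain_to0.
have pb j : p j -> (j <= k)%N by move=> /asboolP /sub /hk.
have [l /asboolP hl ml] := ex_maxnP p0 pb.
exists l; split; first by split=> // j hj; apply: ml; apply/asboolP.
  by apply: pb; apply/asboolP.
move=> elk; apply: contrapT => nIJ.
have /has_chainP [K cK] := hl.
suff /(ex_intro _ K)/has_chainP/hk : chain_to J K l.+1 by rewrite elk ltnn.
elim: cK => {hl ml elk K l} [K iK IK|K K' l _ IH iK' KK'].
  apply: (@chain_toS _ J) => //; first exact: chain_to0.
  by split=> [|KJ]; [exact: subset_trans IK|apply: nIJ; exact: subset_trans KJ].
exact: chain_toS IH iK' KK'.
Qed.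

Lemma finite_length_sub J I : is_ideal J -> is_ideal I -> J `<=` I ->
  finite_length J -> finite_length I.
Proof. by move=> iJ iI JI [k /(has_length_sub iJ iI JI) [l []]]; exists l. Qed.

Lemma quotient_length_le J I : is_ideal J -> is_ideal I -> J `<=` I ->
  finite_length J -> (quotient_length I <= quotient_length J)%N.
Proof.
move=> iJ iI JI /finite_lengthP /(has_length_sub iJ iI JI) [l [hl lk _]].
by rewrite (quotient_lengthE hl).
Qed.

Lemma quotient_length_eq J I : is_ideal J -> is_ideal I -> J `<=` I ->
  finite_length J -> quotient_length I = quotient_length J -> I `<=` J.
Proof.
move=> iJ iI JI /finite_lengthP /(has_length_sub iJ iI JI) [l [hl lk e]].
by rewrite (quotient_lengthE hl).
Qed.

Lemma finite_length_addp J x : is_ideal J ->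
  finite_length (addp J x) -> finite_length (colp J x) -> finite_length J.
Proof.
by move=> iJ [k hk] [l hl]; exists (k + l)%N; exact: has_length_addp hk hl.
Qed.

Lemma quotient_length_addp J x : is_ideal J ->
  finite_length (addp J x) -> finite_length (colp J x) ->
  quotient_length J = (quotient_length (addp J x) + quotient_length (colp J x))%N.
Proof.
move=> iJ /finite_lengthP hk /finite_lengthP hl; apply: quotient_lengthE.
exact: has_length_addp hk hl.
Qed.

Lemma has_lengthT : has_length [set: A] 0.
Proof.
split; first by apply/has_chainP; exists setT; exact: chain_to0.
move=> j /has_chainP [K]; case=> // K0 K' k /chain_to_over [_ h] _ [_ []].
by move=> a _; exact: h.
Qed.

Lemma has_length_maximal I : maximal_ideal I -> has_length I 1.
Proof.
move=> [iI nI mI]; split.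
  apply/has_chainP; exists setT; apply: (@chain_toS _ I) => //.
    exact: chain_to0.
  by split=> // h; apply: nI; exact: h.
have top K k : chain_to I K k.+1 -> K = setT.
  move=> h; inversion h as [|K0 K' k' cK0 iK' lt]; subst.
  have [_ IK0] := chain_to_over cK0; have [K0K nK] := lt.
  apply: ideal1 => //; apply: contrapT => nK1.
  by apply: nK; rewrite (mI K) //; exact: subset_trans K0K.
move=> j /has_chainP [K]; case: j => [//|[//|j] h].
inversion h as [|K0 K' k' cK0 iK' lt]; subst.
by case: lt => _ []; rewrite (top _ _ cK0).
Qed.

(** Without a stable step the colengths of the [S k] would grow strictly and exceed that of J. *)
Lemma finite_length_dcc J (S : nat -> set A) : is_ideal J -> finite_length J ->
  (forall k, is_ideal (S k)) -> (forall k, J `<=` S k) ->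
  (forall k, S k.+1 `<=` S k) -> exists k, S k `<=` S k.+1.
Proof.
move=> iJ [L hL] iS JS dS; apply: contrapT => hn.
have h k : (k <= quotient_length (S k))%N.
  elim: k => // k IH; apply: (leq_ltn_trans IH).
  have fS : finite_length (S k.+1) by apply: (finite_length_sub iJ) => //; exists L.
  rewrite ltn_neqAle (quotient_length_le (iS _)) // andbT; apply/eqP => e.
  by apply: hn; exists k; apply: quotient_length_eq.
have := h L.+1; have := quotient_length_le iJ (iS L.+1) (JS _) (ex_intro _ L hL).
by rewrite (quotient_lengthE hL) => h1 h2; have := leq_trans h2 h1; rewrite ltnn.
Qed.

End Length.

End Ideals.

(** * Noetherian local rings *)

Section Noetherian.
Variable A : comNzRingType.
Hypothesis noethA : noetherian_ring A.

(** If no member were maximal, choice would give a strictly increasing sequence in C; its union is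
    finitely generated, hence reached at a finite stage. *)
Lemma noetherian_max (C : set (set A)) : C `<=` @is_ideal A -> C !=set0 ->
  exists2 I, C I & forall K, C K -> I `<=` K -> K = I.
Proof.
move=> Cid [I0 CI0]; apply: contrapT => nmax.
have step (I : {I | C I}) : exists K : {I | C I}, sval I `<` sval K.
  case: I => I CI /=; apply: contrapT => nK; apply: nmax; exists I => // K CK IK.
  apply/seteqP; split=> //; apply: contrapT => nKI; apply: nK.
  by exists (exist _ K CK).
have [g hg] := choice step.
pose f k := iter k g (exist _ I0 CI0).
have fid k : is_ideal (sval (f k)) by apply: Cid; exact: proj2_sig.
have fS k l : (k <= l)%N -> sval (f k) `<=` sval (f l).
  move=> /subnK <-; elim: (l - k)%N => // j IH; apply: (subset_trans IH).
  by have [] := hg (f (j + k)%N).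
pose U : set A := [set a | exists k, sval (f k) a].
have iU : is_ideal U.
  split; first by exists 0%N; exact: ideal0.
  - move=> a b [k ka] [l lb]; exists (maxn k l); apply: idealD => //.
      by apply: (fS k); rewrite ?leq_maxl.
    by apply: (fS l); rewrite ?leq_maxr.
  - by move=> r a [k ka]; exists k; exact: ideal_mull.
have [s Us] := noethA iU.
have [k hk] : exists k, [set` s] `<=` sval (f k).
  have sU : {in s, forall a, U a} by move=> a sa; rewrite Us; exact: sub_ideal_span.
  elim: s sU {Us} => [_|a s IH sU]; first by exists 0%N.
  have [k hk] : exists k, [set` s] `<=` sval (f k).
    by apply: IH => b bs; apply: sU; rewrite inE bs orbT.
  have [l la] := sU a (mem_head _ _); exists (maxn k l) => b.
  rewrite /= inE => /orP [/eqP ->|bs]; first by apply: (fS l); rewrite ?leq_maxr.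
  by apply: (fS k); rewrite ?leq_maxl //; exact: hk.
have [_] := hg (f k); apply=> a ha.
suff: U a by rewrite Us; exact: ideal_spanS.
by exists k.+1.
Qed.

Variable m : set A.
Hypothesis locA : local_ring m.

Lemma local_ideal : is_ideal m. Proof. by have [[]] := locA. Qed.
Lemma local_proper : ~ m 1. Proof. by have [[]] := locA. Qed.
Lemma local_maximal : maximal_ideal m. Proof. by have [] := locA. Qed.

Lemma local_max I : is_ideal I -> ~ I 1 -> I `<=` m.
Proof.
move=> iI nI1.
pose C := [set K : set A | [/\ is_ideal K, ~ K 1 & I `<=` K]].
have [||M [iM nM IM] maxM] := @noetherian_max C.
- by move=> K [].
- by exists I; split.
have <- // : M = m.
apply: (proj2 locA); split=> // K iK nK MK; apply: maxM => //; split=> //.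
exact: subset_trans MK.
Qed.

Lemma local_inv a : ~ m a -> exists b, b * a = 1.
Proof.
move=> nma; apply: contrapT => ninv.
have i0 : is_ideal [set 0 : A].
  by split=> //= [a' b -> ->|r a' ->]; rewrite ?addr0 ?mulr0.
apply: nma; apply: (local_max (is_ideal_addp a i0)); last exact: addp_id.
by move=> [r /= /eqP]; rewrite subr_eq0 => /eqP h; apply: ninv; exists r.
Qed.

Lemma local_unitB J a b : is_ideal J -> m a -> J (b * (1 - a)) -> J b.
Proof.
move=> iJ ma Jb; have [c hc] : exists c, c * (1 - a) = 1.
  apply: local_inv => h; apply: local_proper; rewrite -[1](subrK a).
  by apply: idealD => //; exact: local_ideal.
by rewrite -[b]mulr1 -hc mulrCA; exact: ideal_mull.
Qed.

(** The hypothesis is S = T + mS with one product y p per element. Noetherian induction: an ideal L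
    between T and S, maximal among those different from S, is shown to contain mS, hence S. *)
Lemma nakayama S T : is_ideal S -> is_ideal T -> T `<=` S ->
  (forall s, S s -> exists t p, [/\ T t, S p & exists2 y, m y & s = t + y * p]) ->
  S `<=` T.
Proof.
move=> iS iT TS h; apply: contrapT => nST.
pose C := [set K : set A | [/\ is_ideal K, T `<=` K, K `<=` S & ~ (S `<=` K)]].
have [||L [iL TL LS nSL] maxL] := @noetherian_max C.
- by move=> K [].
- by exists T; split.
suff mS y s : m y -> S s -> L (y * s).
  apply: nSL => s /h [t [p [Tt Sp [y my ->]]]].
  by apply: idealD => //; [exact: TL|exact: mS].
move=> my Ss; apply: contrapT => nL.
have Sys : S (y * s) by exact: ideal_mull.
(* By maximality L + (y s) is all of S and contains s; then s (1 - r y) lies in L, and 1 - r y is a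
   unit. *)
have [r Lr] : addp L (y * s) s.
  apply: contrapT => ns; apply: nL.
  rewrite -(maxL (addp L (y * s))); first exact: addp_id.
  - split; first exact: is_ideal_addp.
    + exact: subset_trans (@addp_sub _ _ _).
    + exact: addp_min.
    + by move=> /(_ _ Ss).
  - exact: addp_sub.
apply: nL; apply: ideal_mull => //; apply: (@local_unitB _ (r * y)) => //.
  by apply: ideal_mull => //; exact: local_ideal.
by have -> : s * (1 - r * y) = s - r * (y * s) by ring.
Qed.

(** Noetherian induction: if J is a maximal counterexample and y is in m but not in J, then J + yA
    and J : y are strictly larger, so they have finite colength, and then so has J. *)
Lemma finite_length_primary J0 : is_ideal J0 ->
  (forall y, m y -> exists k, J0 (y ^+ k)) -> finite_length J0.
Proof.
move=> iJ0 pJ0; apply: contrapT => nJ0.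
pose C := [set K : set A | [/\ is_ideal K,
  (forall y, m y -> exists k, K (y ^+ k)) & ~ finite_length K]].
have [||J [iJ pJ nJ] maxJ] := @noetherian_max C.
- by move=> K [].
- by exists J0; split.
have fin K : is_ideal K -> J `<=` K -> ~ (K `<=` J) -> finite_length K.
  move=> iK JK nK; apply: contrapT => nf; apply: nK.
  rewrite (maxJ K) //; split=> // y /pJ [k /JK]; by exists k.
have [J1|nJ1] := EM (J 1).
  by apply: nJ; rewrite (ideal1 iJ J1); exists 0%N; exact: has_lengthT.
have Jm := local_max iJ nJ1.
have [mJ|] := EM (m `<=` J).
  apply: nJ; exists 1%N; have -> : J = m by apply/seteqP; split.
  exact: has_length_maximal local_maximal.
move=> /existsNP [y /not_implyP [my nJy]].
apply: nJ; apply: (@finite_length_addp _ _ y) => //; apply: fin.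
- exact: is_ideal_addp.
- exact: addp_sub.
- by move=> /(_ _ (addp_id y iJ)).
- exact: is_ideal_colp.
- exact: colp_sub.
(* For the least k with y^k in J, the power y^(k-1) lies in J : y but not in J. *)
have pk : exists k, `[< J (y ^+ k) >] by have [k hk] := pJ y my; exists k; apply/asboolP.
have [[|k] /asboolP hk mk] := ex_minnP pk; first by case: nJ1.
move=> h; have : J (y ^+ k) by apply: h; rewrite /colp /= -exprSr.
by move=> /asboolP /mk; rewrite ltnn.
Qed.

Lemma colp_exp_stable (J : set A) (x : A) : is_ideal J ->
  exists K, forall k, colp J (x ^+ k) `<=` colp J (x ^+ K).
Proof.
move=> iJ; pose C : set (set A) := [set K | exists k, K = colp J (x ^+ k)].
have [||_ [K ->] maxK] := @noetherian_max C.
- by move=> _ [k ->]; exact: is_ideal_colp.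
- by exists (colp J (x ^+ 0)), 0%N.
exists K => k; rewrite -(maxK (colp J (x ^+ maxn k K))).
- by apply: colp_exp_le; rewrite ?leq_maxl.
- by exists (maxn k K).
- by apply: colp_exp_le; rewrite ?leq_maxr.
Qed.

End Noetherian.

(** * Eventually polynomial functions *)

Section EventuallyPolynomial.
Implicit Types (F G : nat -> int) (r d n a : nat).

(* F agrees with a polynomial of degree < r for large arguments. *)
Fixpoint eventually_poly r F : Prop :=
  if r is r'.+1 then eventually_poly r' (fun n => F n - F n.-1)
  else exists N, forall n, (N <= n)%N -> F n = 0.

Lemma eventually_poly_ext r F G : (exists N, forall n, (N <= n)%N -> F n = G n) ->
  eventually_poly r F -> eventually_poly r G.
Proof.
elim: r F G => [|r IH] F G [N FG] /=.
  move=> [N' h]; exists (maxn N N') => n; rewrite geq_max => /andP [n1 n2].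
  by rewrite -FG // h.
apply: IH; exists N.+1 => n hn; rewrite !FG //; lia.
Qed.

Lemma eventually_poly0 r : eventually_poly r (fun=> 0).
Proof.
elim: r => [|r IH] /=; first by exists 0%N.
by apply: eventually_poly_ext IH; exists 0%N => n _; rewrite subrr.
Qed.

Lemma eventually_polyB r F G : eventually_poly r F -> eventually_poly r G ->
  eventually_poly r (fun n => F n - G n).
Proof.
elim: r F G => [|r IH] F G /=.
  move=> [N hF] [N' hG]; exists (maxn N N') => n; rewrite geq_max => /andP [n1 n2].
  by rewrite hF // hG // subrr.
move=> hF hG; apply: eventually_poly_ext (IH _ _ hF hG).
by exists 0%N => n _; ring.
Qed.

Lemma eventually_polyD r F G : eventually_poly r F -> eventually_poly r G ->
  eventually_poly r (fun n => F n + G n).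
Proof.
move=> hF hG; have := eventually_polyB (eventually_poly0 r) hG.
move=> /(eventually_polyB hF); apply: eventually_poly_ext.
by exists 0%N => n _; ring.
Qed.

Lemma eventually_poly_pred r F :
  eventually_poly r F -> eventually_poly r (fun n => F n.-1).
Proof.
elim: r F => [|r IH] F /=; last by move/IH.
by move=> [N h]; exists N.+1 => n hn; apply: h; lia.
Qed.

Lemma eventually_poly_shift r F a :
  eventually_poly r F -> eventually_poly r (fun n => F (n - a)%N).
Proof.
move=> h; elim: a => [|a IH].
  by apply: eventually_poly_ext h; exists 0%N => n _; rewrite subn0.
apply: eventually_poly_ext (eventually_poly_pred IH).
by exists 0%N => n _; congr F; lia.
Qed.

Lemma eventually_polyS r F : eventually_poly r F -> eventually_poly r.+1 F.
Proof. by move=> h; apply: eventually_polyB => //; exact: eventually_poly_pred. Qed.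

Lemma eventually_poly_psum r F : eventually_poly r F ->
  eventually_poly r.+1 (fun n => \sum_(j < n.+1) F j).
Proof.
apply: eventually_poly_ext; exists 1%N => -[//|n] _.
by rewrite big_ord_recr /=; ring.
Qed.

Lemma eventually_poly_sum r a (H : nat -> nat -> int) :
  (forall j, eventually_poly r (H j)) ->
  eventually_poly r (fun n => \sum_(j < a) H j n).
Proof.
move=> h; elim: a => [|a IH].
  apply: eventually_poly_ext (eventually_poly0 r).
  by exists 0%N => n _; rewrite big_ord0.
apply: eventually_poly_ext (eventually_polyD IH (h a)).
by exists 0%N => n _; rewrite big_ord_recr.
Qed.

(** The expansion of the difference is summed: by Pascal's rule binom(n + i + 1, i + 1) has backward
    difference binom(n + i, i). The value at N fixes the constant term. *)
Lemma eventually_poly_binom r F : eventually_poly r F ->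
  exists (c : nat -> int) N, forall n, (N <= n)%N ->
    F n = \sum_(i < r) c i * ('C(n + i, i))%:Z.
Proof.
elim: r F => [|r IH] F /=.
  by move=> [N h]; exists (fun=> 0), N => n hn; rewrite big_ord0 h.
move=> /IH [c [N h]].
pose G n := \sum_(i < r) c i * ('C((n + i).+1, i.+1))%:Z.
exists (fun i => if i is i'.+1 then c i' else F N - G N), N => n hn.
rewrite big_ord_recl /= bin0 mulr1.
under eq_bigr do rewrite /bump /= add1n addnS.
suff : F n - G n = F N - G N by rewrite -/(G n) => <-; rewrite subrK.
rewrite -(subnK hn); elim: (n - N)%N => [//|j IHj]; rewrite -IHj.
have := h (j.+1 + N)%N; rewrite addSn /= => /(_ (leqW (leq_addl _ _))) e.
have -> : F (j + N).+1 = F (j + N)%N + (F (j + N).+1 - F (j + N)%N) by ring.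
rewrite e; suff -> : G (j + N).+1 = G (j + N)%N + (F (j + N).+1 - F (j + N)%N).
  by rewrite e; ring.
rewrite e /G -big_split /=; apply: eq_bigr => i _.
by rewrite -mulrDr -PoszD; congr (_ * Posz _); rewrite addSn binS.
Qed.

Lemma eventually_poly_hilbert d F : eventually_poly d.+1 F ->
  exists (e : nat -> int) N, forall k, (N <= k)%N ->
    F k = \sum_(i < d.+1) (-1) ^+ i * e i * ('C(k + d - i, d - i))%:Z.
Proof.
move=> /eventually_poly_binom [c [N h]].
exists (fun i => (-1) ^+ i * c (d - i)%N), N => k hk.
rewrite h // (reindex_inj rev_ord_inj) /=; apply: eq_bigr => i _.
rewrite mulrA -exprD addnn -mul2n exprM sqrrN !expr1n mul1r subSS.
by congr (_ * Posz 'C(_, _)); have := ltn_ord i; lia.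
Qed.

(** The vectors come in increasing lexicographic order, on which the filtration by monomials
    relies. *)
Fixpoint exps d n : seq (seq nat) :=
  if d is d'.+1 then [seq a :: al | a <- iota 0 n.+1, al <- exps d' (n - a)]
  else if n is 0 then [:: [::]] else [::].

Lemma mem_exps d n al : (al \in exps d n) = (size al == d) && (sumn al == n).
Proof.
elim: d n al => [|d IH] n al; first by case: n al => [|n] [|x al].
apply/allpairsPdep/idP => [[a [be [ha hbe ->]]]|].
  move: ha hbe; rewrite (mem_iota 0 n.+1) IH /= eqSS => ha /andP [-> /eqP ->]; lia.
case: al => [//|a al] /=; rewrite eqSS => /andP [sal /eqP nal].
exists a, al; split=> //; first by rewrite (mem_iota 0 n.+1); lia.
by rewrite IH sal; apply/eqP; lia.
Qed.

Lemma sum_expsS d n (f : seq nat -> int) :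
  \sum_(al <- exps d.+1 n) f al =
  \sum_(a < n.+1) \sum_(al <- exps d (n - a)) f (nat_of_ord a :: al).
Proof.
by rewrite big_allpairs_dep -(big_mkord xpredT
  (fun a => \sum_(al <- exps d (n - a)) f (a :: al))) /index_iota subn0.
Qed.

Definition antitone d (f : seq nat -> nat) := forall al be,
  size al = d -> all2 leq al be -> (f be <= f al)%N.

Lemma all2_leq_refl al : all2 leq al al.
Proof. by elim: al => //= a al ->; rewrite leqnn. Qed.

Lemma nonincreasing_stable (u : nat -> nat) :
  (forall n, (u n.+1 <= u n)%N) -> exists a, forall n, (a <= n)%N -> u n = u a.
Proof.
move=> h.
have mono k l : (k <= l)%N -> (u l <= u k)%N.
  move=> /subnK <-; elim: (l - k)%N => // j; apply: leq_trans; exact: h.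
have ex : exists k, `[< exists n, u n = k >] by exists (u 0%N); apply/asboolP; exists 0%N.
have [k /asboolP [a <-] mk] := ex_minnP ex.
exists a => n an; apply/eqP; rewrite eqn_leq mono //=.
by apply: mk; apply/asboolP; exists n.
Qed.

(** The threshold a0 is uniform in the other entries. By induction the diagonal values f (b, b, ...)
    are constant from some k0 on; each second entry below k0 has its own threshold, and for the
    others the values are squeezed between diagonal ones. *)
Lemma antitone_stable d (f : seq nat -> nat) : antitone d.+1 f ->
  exists a0, forall a, (a0 <= a)%N ->
    forall al, size al = d -> f (a :: al) = f (a0 :: al).
Proof.
elim: d f => [|d IH] f hf.
  have [|a0 ha0] := @nonincreasing_stable (fun a => f [:: a]).
    by move=> n; apply: hf => //=; rewrite andbT.
  by exists a0 => a /ha0 e [|].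
have [|k0 hk0] := IH (fun al => f (head 0%N al :: al)).
  move=> [//|a al] [//|b be] /= [sal] /andP [ab albe]; apply: hf => //=.
    by rewrite sal.
  by rewrite ab albe.
have hb b : exists ab, forall a, (ab <= a)%N ->
    forall al, size al = d -> f (a :: b :: al) = f (ab :: b :: al).
  have [|ab hab] := IH (fun al => f (head 0%N al :: b :: behead al)).
    move=> [//|a al] [//|c be] /= [sal] /andP [ac albe]; apply: hf => //=.
      by rewrite sal.
    by rewrite ac leqnn albe.
  by exists ab.
have [s hs] := choice hb.
pose a0 := maxn k0 (\max_(b < k0) s b).
exists a0 => a ha [//|b al] [sal].
have [bk|kb] := ltnP b k0.
  have sb : (s b <= a0)%N by rewrite leq_max (leq_bigmax (Ordinal bk)) orbT.
  by rewrite (hs b a) ?(hs b a0) //; exact: leq_trans ha.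
have sq c : (k0 <= c)%N -> f (c :: b :: al) = f [:: k0, k0 & al].
  move=> kc; apply/eqP; rewrite eqn_leq; apply/andP; split.
    by apply: hf; rewrite /= ?sal // kc kb all2_leq_refl.
  rewrite -(hk0 (maxn c b)) //; last by rewrite leq_max kc.
  by apply: hf; rewrite /= ?sal // leq_maxl leq_maxr all2_leq_refl.
by rewrite !sq // ?leq_maxl //; apply: leq_trans ha; rewrite leq_maxl.
Qed.

(** The slices [S a] by the first entry are covered by induction and agree with [S a0] for a >= a0.
    The whole sum is the summatory function of [S a0] plus finitely many shifted corrections. *)
Lemma eventually_poly_antitone d (f : seq nat -> nat) : antitone d f ->
  eventually_poly d (fun n => \sum_(al <- exps d n) (f al)%:Z).
Proof.
elim: d f => [|d IH] f hf; first by exists 1%N => -[|n] //= _; rewrite big_nil.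
have [a0 ha0] := antitone_stable hf.
pose S a n := \sum_(al <- exps d n) (f (a :: al))%:Z.
have hS a : eventually_poly d (S a).
  by apply: IH => al be sal albe; apply: hf; rewrite /= ?sal // leqnn.
have eS a n : (a0 <= a)%N -> S a n = S a0 n.
  move=> ha; apply: eq_big_seq => al; rewrite mem_exps => /andP [/eqP sal _].
  by rewrite ha0.
have h1 : eventually_poly d.+1 (fun n => \sum_(j < a0) (S j (n - j)%N - S a0 (n - j)%N)).
  apply: eventually_polyS; apply: (@eventually_poly_sum _ _
    (fun j n => S j (n - j)%N - S a0 (n - j)%N)) => j.
  by apply: eventually_polyB; exact: eventually_poly_shift.
apply: eventually_poly_ext (eventually_polyD (eventually_poly_psum (hS a0)) h1).
exists a0 => n hn; rewrite sum_expsS (reindex_inj rev_ord_inj) /=.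
rewrite -(big_mkord xpredT (fun j => S j (n - j)%N - S a0 (n - j)%N)).
have -> : \sum_(0 <= j < a0) (S j (n - j)%N - S a0 (n - j)%N) =
          \sum_(0 <= j < n.+1) (S j (n - j)%N - S a0 (n - j)%N).
  rewrite [RHS](big_cat_nat (n := a0)) ?(leqW hn) //= [X in _ + X]big_nat_cond.
  by rewrite [X in _ + X]big1 ?addr0 // => j /andP [/andP [/eS e _] _]; rewrite e subrr.
rewrite big_mkord -big_split /=; apply: eq_bigr => j _.
by rewrite subSS addrC subrK.
Qed.

End EventuallyPolynomial.

(** * Leading coefficients of Hilbert polynomials *)

Section Asymptotics.
Implicit Types (F G : nat -> int) (c : int) (d k : nat).

(* F k = c k^d + O(k^(d-1)), multiplied by k so as to include d = 0. *)
Definition asymp d c F := exists2 K : int, 0 <= K &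
  forall k, k%:Z * `|F k - c * k%:Z ^+ d| <= K * k%:Z ^+ d.

Lemma asymp_ext d c F G : F =1 G -> asymp d c F -> asymp d c G.
Proof. by move=> FG [K K0 h]; exists K => // k; rewrite -FG. Qed.

Lemma asymp_cst c : asymp 0 c (fun=> c).
Proof. by exists 0 => // k; rewrite expr0 mulr1 subrr normr0 mulr0. Qed.

Lemma asympD d c c' F G : asymp d c F -> asymp d c' G ->
  asymp d (c + c') (fun k => F k + G k).
Proof.
move=> [K K0 hK] [L L0 hL]; exists (K + L); first exact: addr_ge0.
move=> k; rewrite [leRHS]mulrDl; apply: le_trans (lerD (hK k) (hL k)).
rewrite -mulrDr; apply: ler_wpM2l => //.
apply: le_trans (ler_normD _ _); rewrite le_eqVlt; apply/orP; left; apply/eqP.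
by congr `| _ |; ring.
Qed.

Lemma asympZ d c a F : asymp d c F -> asymp d (a * c) (fun k => a * F k).
Proof.
move=> [K K0 hK]; exists (`|a| * K); first exact: mulr_ge0.
move=> k; rewrite -mulrA -mulrBr normrM mulrCA -mulrA.
exact: ler_wpM2l.
Qed.

Lemma asymp_lower d c F : asymp d c F -> asymp d.+1 0 F.
Proof.
move=> [K K0 hK]; exists (K + `|c|); first exact: addr_ge0.
case=> [|k]; first by rewrite mul0r exprS mul0r mulr0.
set x := (k.+1)%:Z; have x1 : 1 <= x by [].
have x0 : 0 <= x by exact: le_trans x1.
rewrite mul0r subr0 [leRHS]mulrDl.
have -> : F k.+1 = (F k.+1 - c * x ^+ d) + c * x ^+ d by rewrite subrK.
apply: (le_trans (ler_wpM2l x0 (ler_normD _ _))); rewrite mulrDr; apply: lerD.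
  apply: (le_trans (hK k.+1)); apply: ler_wpM2l => //.
  by rewrite exprS ler_peMl // exprn_ge0.
by rewrite normrM [`|x ^+ d|]ger0_norm ?exprn_ge0 // mulrCA -exprS.
Qed.

Lemma asymp_mul_linear d c F (p q : nat) : asymp d c F ->
  asymp d.+1 (c * p%:Z) (fun k => F k * (p * k + q)%N%:Z).
Proof.
move=> [K K0 hK]; exists (K * (p + q)%N%:Z + `|c| * q%:Z).
  by apply: addr_ge0; apply: mulr_ge0.
case=> [|k]; first by rewrite mul0r exprS mul0r mulr0.
set x := (k.+1)%:Z; have x1 : 1 <= x by [].
have x0 : 0 <= x by exact: le_trans x1.
have -> : F k.+1 * (p * k.+1 + q)%N%:Z - c * p%:Z * x ^+ d.+1 =
  (F k.+1 - c * x ^+ d) * (p * k.+1 + q)%N%:Z + c * x ^+ d * q%:Z.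
  by rewrite PoszD PoszM -/x exprS; ring.
apply: (le_trans (ler_wpM2l x0 (ler_normD _ _))).
rewrite mulrDr [leRHS]mulrDl; apply: lerD.
  rewrite normrM mulrA.
  apply: (le_trans (ler_wpM2r (normr_ge0 _) (hK k.+1))).
  rewrite -!mulrA; apply: ler_wpM2l => //; rewrite -/x.
  rewrite mulrC exprS mulrA; apply: ler_wpM2r; first exact: exprn_ge0.
  rewrite ger0_norm // -PoszM lez_nat; nia.
rewrite !normrM [`|x ^+ d|]ger0_norm ?exprn_ge0 // [`|q%:Z|]ger0_norm // exprS.
by rewrite le_eqVlt; apply/orP; left; apply/eqP; ring.
Qed.

Lemma asymp_le d c c' F G : asymp d c F -> asymp d c' G ->
  (exists N, forall k, (N <= k)%N -> F k <= G k) -> c <= c'.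
Proof.
move=> [K K0 hK] [L L0 hL] [N h]; rewrite leNgt; apply/negP => lt.
(* This k exceeds N and both error constants together, while c > c' would force k <= K + L. *)
pose k := (N + absz (K + L)%R).+1.
have := hK k; have := hL k; have := h k (leqW (leq_addr _ _)).
set y := k%:Z ^+ d => hFG hG hF.
have y0 : 0 < y by rewrite exprn_gt0.
have KLk : K + L < k%:Z by rewrite /k; have := ler_norm (K + L); lia.
have k0 : 0 <= k%:Z by [].
have e : y <= `|F k - c * y| + `|G k - c' * y|.
  have := ler_norm (- (F k - c * y)); have := ler_norm (G k - c' * y).
  rewrite normrN => h1 h2.
  have : y <= (c - c') * y by rewrite ler_peMl ?(ltW y0) // lerBrDr; lia.
  rewrite mulrBl; move: h1 h2 hFG; set a := c * y; set b := c' * y; lia.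
have : k%:Z * y <= (K + L) * y.
  apply: (le_trans (ler_wpM2l k0 e)); rewrite mulrDr mulrDl; exact: lerD.
by rewrite ler_pM2r // leNgt KLk.
Qed.

Lemma fact_binD (n j : nat) : (j`! * 'C(n + j, j) = \prod_(t < j) (n + t.+1))%N.
Proof.
elim: j => [|j IH]; first by rewrite big_ord0 bin0.
rewrite big_ord_recr /= -IH factS !addnS [(j.+1 * _)%N]mulnC -mulnA -mul_bin_diag /=.
by rewrite [((n + j).+1 * _)%N]mulnC mulnA.
Qed.

Lemma asymp_bin (p q j : nat) :
  asymp j (p%:Z ^+ j) (fun k => (j`!)%:Z * ('C(p * k + q + j, j))%:Z).
Proof.
apply: (@asymp_ext _ _ (fun k => \prod_(t < j) (p * k + (q + t.+1))%N%:Z)).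
  move=> k; rewrite -PoszM fact_binD -(big_morph Posz PoszM (erefl 1%:Z)).
  by congr Posz; apply: eq_bigr => t _; rewrite addnA.
elim: j => [|j IH].
  by apply: asymp_ext (asymp_cst _) => k; rewrite big_ord0.
rewrite exprSr; apply: asymp_ext (asymp_mul_linear p (q + j.+1) IH) => k.
by rewrite big_ord_recr.
Qed.

Lemma asymp_bin_lower (d p q j : nat) c : (j < d)%N ->
  asymp d 0 (fun k => c * ('C(p * k + q + j, j))%:Z * (d`!)%:Z).
Proof.
move=> jd; have jf : (j`! %| d`!)%N by rewrite -(bin_fact (ltnW jd)) mulnCA dvdn_mulr.
set G := fun k => _; have hG : asymp j.+1 0 G.
  have h := asymp_lower (asympZ (c * (d`! %/ j`!)%N%:Z) (asymp_bin p q j)).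
  apply: asymp_ext h => k.
  by rewrite mulrA -[c * _ * _]mulrA -PoszM divnK // mulrAC.
suff h i : asymp (i + j.+1) 0 G by rewrite -(subnK jd); exact: h.
by elim: i => // i IH; rewrite addSn; exact: asymp_lower IH.
Qed.

(** The factor d! clears denominators, so the leading coefficient in k is the integer e_0 p^d; the
    terms with i > 0 have lower degree. *)
Lemma asymp_hilbert (e : nat -> int) (d p q : nat) :
  asymp d (e 0%N * p%:Z ^+ d)
  (fun k => (d`!)%:Z * \sum_(i < d.+1) (-1) ^+ i * e i *
     ('C(p * k + q + d - i, d - i))%:Z).
Proof.
have h0 := asympZ (e 0%N) (asymp_bin p q d).
have h1 s : asymp d 0 (fun k => \sum_(i <- s | (i < d)%N)
    (-1) ^+ i.+1 * e i.+1 * ('C(p * k + q + (d - i.+1), d - i.+1))%:Z * (d`!)%:Z).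
  elim: s => [|i s IH].
    by exists 0 => // k; rewrite big_nil mul0r subrr normr0 mulr0.
  have [id|id] := ltnP i d; last first.
    by apply: asymp_ext IH => k; rewrite big_cons ltnNge id.
  have hl : (d - i.+1 < d)%N by lia.
  have := asympD (asymp_bin_lower p q ((-1) ^+ i.+1 * e i.+1) hl) IH.
  by rewrite addr0; apply: asymp_ext => k; rewrite big_cons id.
have := asympD h0 (h1 (index_iota 0 d)); rewrite addr0; apply: asymp_ext => k.
rewrite big_ord_recl /= expr0 mul1r !subn0 mulrDr; congr (_ + _); first by ring.
rewrite big_mkord mulr_sumr; apply: eq_big => [i|i _]; first by rewrite ltn_ord.
rewrite mulrC /bump /= add1n.
by congr (_ * (_ * Posz 'C(_, _))); have := ltn_ord i; lia.
Qed.

(** The substitutions p k + q and p' k + q' serve to compare filtrations of different speeds, such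
    as the powers of (x_1, ..., x_d) and of (x_1^n, ..., x_d^n). *)
Lemma hilbert_leading_le (e e' : nat -> int) (d p q p' q' : nat) (F G : nat -> int) :
  (exists N, forall k, (N <= k)%N ->
     F k = \sum_(i < d.+1) (-1) ^+ i * e i * ('C(k + d - i, d - i))%:Z) ->
  (exists N, forall k, (N <= k)%N ->
     G k = \sum_(i < d.+1) (-1) ^+ i * e' i * ('C(k + d - i, d - i))%:Z) ->
  (0 < p)%N -> (0 < p')%N ->
  (exists N, forall k, (N <= k)%N -> F (p * k + q)%N <= G (p' * k + q')%N) ->
  e 0%N * p%:Z ^+ d <= e' 0%N * p'%:Z ^+ d.
Proof.
move=> [N hF] [N' hG] p0 p0' [M h].
apply: asymp_le (asymp_hilbert e d p q) (asymp_hilbert e' d p' q') _.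
exists (N + N' + M)%N => k hk; apply: ler_wpM2l => //.
by rewrite -hF; [rewrite -hG; [apply: h|]|]; nia.
Qed.

Lemma hilbert_leading_ge0 (e : nat -> int) (d : nat) (F : nat -> int) :
  (exists N, forall k, (N <= k)%N ->
     F k = \sum_(i < d.+1) (-1) ^+ i * e i * ('C(k + d - i, d - i))%:Z) ->
  (forall k, 0 <= F k) -> 0 <= e 0%N.
Proof.
move=> hF F0; have : 0 * 1%:Z ^+ d <= e 0%N * 1%:Z ^+ d.
  apply: (@hilbert_leading_le (fun=> 0) e d 1 0 1 0 (fun=> 0) F) => //.
    by exists 0%N => k _; rewrite big1 // => i _; rewrite mulr0 mul0r.
  by exists 0%N.
by rewrite expr1n !mulr1.
Qed.

End Asymptotics.

(** * Hilbert-Samuel functions *)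

Section Monomials.
Variable A : comNzRingType.
Implicit Types (I J K : set A) (xs : seq A) (al be ga : seq nat).

Lemma ideal_exp_mul I i j a b :
  ideal_exp I i a -> ideal_exp I j b -> ideal_exp I (i + j) (a * b).
Proof.
elim: i a => [a _|i IH a ha]; first by apply: ideal_mull; exact: is_ideal_exp.
move=> hb; suff : colp (ideal_exp I (i.+1 + j)) b a by [].
move: a ha; apply: ideal_mul_sub.
  by apply: is_ideal_colp; exact: is_ideal_exp.
move=> a c Ia hc; rewrite /colp /= -mulrA.
by apply: ideal_mul_in => //; exact: IH.
Qed.

Lemma ideal_expX I i a : I a -> ideal_exp I i (a ^+ i).
Proof. by move=> Ia; elim: i => // i IH; rewrite exprS; exact: ideal_mul_in. Qed.

Lemma ideal_exp_le I i j : (i <= j)%N -> ideal_exp I j `<=` ideal_exp I i.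
Proof.
move=> /subnK <-; elim: (j - i)%N => // k IH; apply: subset_trans IH.
apply: ideal_mul_sub; first exact: is_ideal_exp.
by move=> a b _; apply: ideal_mull; exact: is_ideal_exp.
Qed.

Fixpoint mono xs al : A :=
  if xs is x :: xs' then if al is a :: al' then x ^+ a * mono xs' al' else 1
  else 1.

Fixpoint add_exp al be : seq nat :=
  if al is a :: al' then if be is b :: be' then (a + b)%N :: add_exp al' be'
  else [::] else [::].

Lemma size_add_exp al be : size al = size be -> size (add_exp al be) = size be.
Proof. by elim: al be => [|a al IH] [|b be] //= [/IH ->]. Qed.

Lemma sumn_add_exp al be : size al = size be ->
  sumn (add_exp al be) = (sumn al + sumn be)%N.
Proof. by elim: al be => [|a al IH] [|b be] //= [/IH ->]; lia. Qed.

Lemma mono_add_exp xs al be : size al = size xs -> size be = size xs ->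
  mono xs (add_exp al be) = mono xs al * mono xs be.
Proof.
elim: xs al be => [|x xs IH] [|a al] [|b be] //=; rewrite ?mulr1 //.
by move=> [sal] [sbe]; rewrite IH // exprD; ring.
Qed.

Lemma le_exp_add al be : all2 leq al be ->
  exists2 ga, size ga = size al & be = add_exp al ga.
Proof.
elim: al be => [|a al IH] [|b be] //=; first by exists [::].
move=> /andP [ab /IH [ga sga ->]]; exists ((b - a)%N :: ga) => /=; first by rewrite sga.
by rewrite subnKC.
Qed.

Lemma mono_nseq0 xs : mono xs (nseq (size xs) 0%N) = 1.
Proof. by elim: xs => //= x xs ->; rewrite mulr1. Qed.

Lemma mono_mulX xs x al : x \in xs -> size al = size xs ->
  exists be, [/\ size be = size xs, sumn be = (sumn al).+1 &
                 mono xs be = x * mono xs al].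
Proof.
elim: xs al => [//|y xs IH] [//|a al] /=.
rewrite inE => /orP [/eqP -> [sal]|/IH h [/h [be [sbe nbe mbe]]]].
  by exists (a.+1 :: al) => /=; rewrite sal exprS mulrA.
by exists (a :: be); rewrite /= sbe nbe mbe addnS mulrCA.
Qed.

Lemma mono_ideal_exp xs I al : {in xs, forall x, I x} -> size al = size xs ->
  ideal_exp I (sumn al) (mono xs al).
Proof.
elim: xs al => [|x xs IH] [|a al] //= hI [sal]; apply: ideal_exp_mul.
  by apply: ideal_expX; apply: hI; rewrite mem_head.
by apply: IH => // y hy; apply: hI; rewrite inE hy orbT.
Qed.

Definition mono_span xs (P : set (seq nat)) : set A :=
  ideal_span [set mono xs al | al in P].

Lemma is_ideal_mono_span xs P : is_ideal (mono_span xs P).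
Proof. exact: is_ideal_span. Qed.

Lemma mono_span_in xs (P : set (seq nat)) al : P al -> mono_span xs P (mono xs al).
Proof. by move=> Pal; apply: sub_ideal_span; exists al. Qed.

Lemma mono_span_sub xs (P : set (seq nat)) K : is_ideal K ->
  (forall al, P al -> K (mono xs al)) -> mono_span xs P `<=` K.
Proof. by move=> iK h; apply: ideal_spanS => // _ [al Pal <-]; exact: h. Qed.

Lemma ideal_exp_mono xs n : ideal_exp (ideal_span [set` xs]) n =
  mono_span xs [set al | size al = size xs /\ sumn al = n].
Proof.
apply/seteqP; split; last first.
  apply: mono_span_sub; first exact: is_ideal_exp.
  move=> al [sal <-]; apply: mono_ideal_exp => // x hx.
  exact: sub_ideal_span.
elim: n => [|n IH].
  rewrite (@ideal1 _ (mono_span _ _)) //; first exact: is_ideal_mono_span.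
  rewrite -(mono_nseq0 xs); apply: mono_span_in.
  by rewrite /= size_nseq sumn_nseq mul0n.
set K := mono_span _ _; have iK : is_ideal K by exact: is_ideal_mono_span.
apply: ideal_mul_sub => // a b ha hb.
suff : ideal_colon K (ideal_exp (ideal_span [set` xs]) n) a by apply.
move: a ha; apply: ideal_spanS; first exact: is_ideal_colon.
move=> x hx c /IH hc; rewrite mulrC; suff : colp K x c by [].
move: c hc; apply: mono_span_sub; first exact: is_ideal_colp.
move=> al [sal nal]; have [be [sbe nbe mbe]] := mono_mulX hx sal.
by rewrite /colp /= mulrC -mbe; apply: mono_span_in; rewrite /= nbe nal.
Qed.

Lemma ideal_exp_mono_le xs n : ideal_exp (ideal_span [set` xs]) n =
  mono_span xs [set al | size al = size xs /\ (n <= sumn al)%N].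
Proof.
apply/seteqP; split.
  rewrite ideal_exp_mono; apply: mono_span_sub; first exact: is_ideal_mono_span.
  by move=> al [sal nal]; apply: mono_span_in; rewrite /= nal.
apply: mono_span_sub; first exact: is_ideal_exp.
move=> al [sal nal]; apply: (ideal_exp_le nal).
by apply: mono_ideal_exp => // x hx; exact: sub_ideal_span.
Qed.

Fixpoint lexlt al be : bool :=
  if al is a :: al' then if be is b :: be' then
    (a < b)%N || (a == b) && lexlt al' be' else false else false.

Definition deglex al be : bool :=
  (sumn al < sumn be)%N || (sumn al == sumn be) && lexlt al be.

Lemma lexlt_irr al : lexlt al al = false.
Proof. by elim: al => //= a al ->; rewrite ltnn eqxx. Qed.

Lemma lexlt_asym al be : lexlt al be -> lexlt be al = false.
Proof.
elim: al be => [|a al IH] [|b be] //=.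
by case: ltngtP => //= _ /IH.
Qed.

Lemma deglex_irr al : deglex al al = false.
Proof. by rewrite /deglex ltnn lexlt_irr andbF. Qed.

Lemma deglex_asym al be : deglex al be -> deglex be al = false.
Proof. by rewrite /deglex; case: ltngtP => //= _ /lexlt_asym. Qed.

Lemma lexlt_add al be ga : size al = size ga -> size be = size ga ->
  lexlt al be -> lexlt (add_exp al ga) (add_exp be ga).
Proof.
elim: al be ga => [|a al IH] [|b be] [|c ga] //= [sal] [sbe].
by rewrite ltn_add2r eqn_add2r => /orP [->//|/andP [-> /IH ->]]; rewrite ?orbT.
Qed.

Lemma deglex_add al be ga : size al = size ga -> size be = size ga ->
  deglex al be -> deglex (add_exp al ga) (add_exp be ga).
Proof.
move=> sal sbe; rewrite /deglex !sumn_add_exp // ltn_add2r eqn_add2r.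
by move=> /orP [->//|/andP [-> /lexlt_add ->]]; rewrite ?orbT.
Qed.

Lemma pairwise_exps d n : pairwise lexlt (exps d n).
Proof.
elim: d n => [|d IH] n; first by case: n.
have : pairwise ltn (iota 0 n.+1) by rewrite -sorted_pairwise ?iota_ltn_sorted //; exact: ltn_trans.
rewrite /exps -/exps; elim: (iota 0 n.+1) => //= a s IHs /andP [/allP ha ps].
rewrite pairwise_cat IHs // andbT pairwise_map; apply/andP; split.
  apply/allrelP => _ _ /mapP [al _ ->] /allpairsPdep [b [be [/ha /= ab _ ->]]] /=.
  by rewrite ab.
by apply: sub_pairwise (IH (n - a)%N) => al be /= ->; rewrite eqxx orbT.
Qed.

Definition exps_le d n := flatten [seq exps d j | j <- iota 0 n.+1].

Lemma mem_exps_le d n al :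
  (al \in exps_le d n) = (size al == d) && (sumn al <= n)%N.
Proof.
apply/flatten_mapP/andP => [[j]|[sal nal]].
  by rewrite mem_iota mem_exps => jn /andP [-> /eqP ->].
by exists (sumn al); rewrite ?mem_iota // mem_exps sal eqxx.
Qed.

Lemma pairwise_exps_le d n : pairwise deglex (exps_le d n).
Proof.
have : pairwise ltn (iota 0 n.+1) by rewrite -sorted_pairwise ?iota_ltn_sorted //; exact: ltn_trans.
rewrite /exps_le; elim: (iota 0 n.+1) => //= j s IHs /andP [/allP hj ps].
rewrite pairwise_cat IHs // andbT; apply/andP; split.
  apply/allrelP => al be; rewrite mem_exps => /andP [_ /eqP nal].
  move=> /flatten_mapP [i /hj /= ji]; rewrite mem_exps => /andP [_ /eqP nbe].
  by rewrite /deglex nal nbe ji.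
have hall : all (mem (exps d j)) (exps d j) by apply/allP.
rewrite (@eq_in_pairwise _ (mem (exps d j)) _ lexlt _ _ hall) ?pairwise_exps //.
move=> al be /=; rewrite !mem_exps => /andP [_ /eqP nal] /andP [_ /eqP nbe].
by rewrite /deglex nal nbe ltnn eqxx.
Qed.

End Monomials.

(** * Colengths of the powers of an ideal as sums over monomials *)

Section HilbertFunction.
Variable A : comNzRingType.
Variable xs : seq A.
Let d := size xs.
Let Q := ideal_span [set` xs].
Hypothesis finQ : finite_length Q.
Implicit Types (al be ga : seq nat).

Definition greater_span al := mono_span xs [set be | size be = d /\ deglex al be].

(* The "initial ideal" at the monomial with exponent al, for the order deglex. *)
Definition initial_ideal al := colp (greater_span al) (mono xs al).

Lemma is_ideal_greater_span al : is_ideal (greater_span al).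
Proof. exact: is_ideal_mono_span. Qed.

Lemma is_ideal_initial al : is_ideal (initial_ideal al).
Proof. by apply: is_ideal_colp; exact: is_ideal_mono_span. Qed.

Lemma initial_ideal_sup al : size al = d -> Q `<=` initial_ideal al.
Proof.
move=> sal; apply: ideal_spanS; first exact: is_ideal_initial.
move=> x hx; have [be [sbe nbe mbe]] := mono_mulX hx sal.
rewrite /initial_ideal /colp /= -mbe; apply: mono_span_in.
by rewrite /= /deglex nbe ltnSn.
Qed.

Lemma finite_length_initial al : size al = d -> finite_length (initial_ideal al).
Proof.
move=> sal; apply: finite_length_sub finQ; first exact: is_ideal_span.
  exact: is_ideal_initial.
exact: initial_ideal_sup.
Qed.

(** Multiplication by a monomial respects [deglex], so the initial ideals grow with the exponent and
    their colengths decrease. *)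
Lemma antitone_initial : antitone d (fun al => quotient_length (initial_ideal al)).
Proof.
move=> al be sal /le_exp_add [ga sga ->].
have sg : size ga = d by rewrite sga.
apply: quotient_length_le; [exact: is_ideal_initial|exact: is_ideal_initial| |].
  move=> a; rewrite /initial_ideal /colp /= mono_add_exp // mulrA.
  move: (a * _) => {a}; apply: mono_span_sub.
    by apply: is_ideal_colp; exact: is_ideal_greater_span.
  move=> de [sde lt]; rewrite /colp /= -mono_add_exp //; apply: mono_span_in.
  split; first by rewrite size_add_exp // sde.
  by apply: deglex_add => //; rewrite ?sde ?sal.
exact: finite_length_initial.
Qed.

(** The monomials of degree at most n are added to Q^(n+1) one at a time, from the last in [deglex]
    down to 1. By [quotient_length_addp] the layer of al has the length of A modulo
    [initial_ideal al]. *)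
Lemma quotient_length_ideal_exp n : finite_length (ideal_exp Q n.+1) /\
  quotient_length (ideal_exp Q n.+1) =
  (\sum_(al <- exps_le d n) quotient_length (initial_ideal al))%N.
Proof.
pose S (t : seq (seq nat)) := mono_span xs
  [set be | be \in t \/ (size be = d /\ (n < sumn be)%N)].
have iS t : is_ideal (S t) by exact: is_ideal_mono_span.
suff h s t : exps_le d n = s ++ t -> (forall be, be \in t -> size be = d) ->
    finite_length (S t) /\
    quotient_length (S t) = (\sum_(al <- s) quotient_length (initial_ideal al))%N.
  have -> : ideal_exp Q n.+1 = S [::].
    rewrite ideal_exp_mono_le; congr mono_span; apply/seteqP.
    by split=> be; [right|case].
  by apply: h; rewrite ?cats0.
elim/last_ind: s t => [|s al IH] t /= est ht.
  suff -> : S t = setT.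
    rewrite big_nil (quotient_lengthE (has_lengthT A)); split=> //.
    by exists 0%N; exact: has_lengthT.
  apply: ideal1 => //; rewrite -(mono_nseq0 xs); apply: mono_span_in.
  by left; rewrite -est mem_exps_le size_nseq sumn_nseq mul0n eqxx.
have est' : exps_le d n = s ++ al :: t by rewrite est cat_rcons.
have [sal nal] : size al = d /\ (sumn al <= n)%N.
  have : al \in exps_le d n by rewrite est' mem_cat mem_head orbT.
  by rewrite mem_exps_le => /andP [/eqP].
have [|fS eS] := IH (al :: t) est'.
  by move=> be; rewrite inE => /orP [/eqP ->|/ht].
have addE : S (al :: t) = addp (S t) (mono xs al).
  apply/seteqP; split.
    apply: mono_span_sub; first exact: is_ideal_addp.
    move=> be [|hbe]; last by apply: addp_sub; apply: mono_span_in; right.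
    rewrite inE => /orP [/eqP ->|bet]; first exact: addp_id.
    by apply: addp_sub; apply: mono_span_in; left.
  apply: addp_min => //; last by apply: mono_span_in; left; rewrite mem_head.
  apply: mono_span_sub => // be [bet|hbe]; apply: mono_span_in; last by right.
  by left; rewrite inE bet orbT.
(* The listed monomials after al and those of degree above n are together exactly the monomials that
   follow al in [deglex]. *)
have SE : S t = greater_span al.
  have := pairwise_exps_le d n; rewrite est' pairwise_cat /=.
  move=> /and3P [/allrelP hs _ /andP [/allP hal _]].
  congr mono_span; apply/seteqP; split=> be.
    move=> [bet|[sbe nbe]]; first by split; [exact: ht|exact: hal].
    by split=> //; rewrite /deglex (leq_ltn_trans nal nbe).
  move=> [sbe lt]; have [nbe|nbe] := ltnP n (sumn be); [by right|left].
  have : be \in exps_le d n by rewrite mem_exps_le sbe eqxx.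
  rewrite est' mem_cat inE => /or3P [bes|/eqP e|//].
    by move: lt; rewrite deglex_asym // hs // mem_head.
  by move: lt; rewrite e deglex_irr.
have fadd : finite_length (addp (S t) (mono xs al)) by rewrite -addE.
have fcol : finite_length (colp (S t) (mono xs al)).
  by rewrite SE; exact: finite_length_initial.
split; first exact: finite_length_addp fadd fcol.
by rewrite (quotient_length_addp _ fadd fcol) // -addE eS SE big_rcons.
Qed.

Lemma eventually_poly_quotient_length :
  eventually_poly d.+1 (fun n => (quotient_length (ideal_exp Q n.+1))%:Z).
Proof.
have := eventually_poly_psum (eventually_poly_antitone antitone_initial).
apply: eventually_poly_ext; exists 0%N => n _.
have [_ ->] := quotient_length_ideal_exp n.
rewrite /exps_le big_flatten big_map -(big_mkord xpredT
  (fun j => \sum_(al <- exps d j) (quotient_length (initial_ideal al))%:Z)).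
rewrite (big_morph Posz PoszD (erefl 0%:Z)) /index_iota subn0.
by apply: eq_bigr => j _; rewrite (big_morph Posz PoszD (erefl 0%:Z)).
Qed.

End HilbertFunction.

(** * Systems of parameters and multiplicities *)

Section Families.
Variable A : comNzRingType.
Variable d : nat.
Implicit Types (x y : 'I_d -> A) (i j : 'I_d) (J K : set A).

Definition others x i : set A :=
  [set a | exists c : 'I_d -> A, a = \sum_(j < d | j != i) c j * x j].

Definition upd x i z : 'I_d -> A := fun j => if j == i then z else x j.

Lemma upd_same x i z : upd x i z i = z.
Proof. by rewrite /upd eqxx. Qed.

Lemma upd_other x i j z : j != i -> upd x i z j = x j.
Proof. by rewrite /upd => /negbTE ->. Qed.

Lemma is_ideal_others x i : is_ideal (others x i).
Proof.
split.
- by exists (fun=> 0); rewrite big1 // => j _; rewrite mul0r.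
- move=> _ _ [a ->] [b ->]; exists (fun j => a j + b j).
  by rewrite -big_split; apply: eq_bigr => j _; rewrite mulrDl.
- move=> r _ [a ->]; exists (fun j => r * a j).
  by rewrite mulr_sumr; apply: eq_bigr => j _; rewrite mulrA.
Qed.

Lemma others_in x i j : j != i -> others x i (x j).
Proof.
move=> ji; exists (fun k => (k == j)%:R).
rewrite (bigD1 j) //= eqxx mul1r big1 ?addr0 // => k /andP [_ /negbTE ->].
by rewrite mul0r.
Qed.

Lemma others_min x i K : is_ideal K -> (forall j, j != i -> K (x j)) ->
  others x i `<=` K.
Proof.
move=> iK h _ [c ->]; apply: ideal_sum => // j ji; apply: ideal_mull => //; exact: h.
Qed.

Lemma others_upd x i z : others (upd x i z) i = others x i.
Proof.
apply/seteqP; split; apply: others_min; try exact: is_ideal_others;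
  move=> j ji.
  by rewrite upd_other //; exact: others_in.
by rewrite -(upd_other x z ji); exact: others_in.
Qed.

Lemma ideal_span_range x i : ideal_span (range x) = addp (others x i) (x i).
Proof.
have io := is_ideal_others x i; have ia := is_ideal_addp (x i) io.
apply/seteqP; split.
  apply: ideal_spanS => // _ [j _ <-]; have [->|ji] := eqVneq j i.
    exact: addp_id.
  by apply: addp_sub; exact: others_in.
apply: addp_min; first exact: is_ideal_span.
  apply: others_min; first exact: is_ideal_span.
  by move=> j _; apply: sub_ideal_span; exists j.
by apply: sub_ideal_span; exists i.
Qed.

Lemma ideal_span_upd x i z :
  ideal_span (range (upd x i z)) = addp (others x i) z.
Proof. by rewrite (ideal_span_range _ i) upd_same others_upd. Qed.

Lemma ideal_span_rangeP x a :
  ideal_span (range x) a <-> exists c : 'I_d -> A, a = \sum_j c j * x j.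
Proof.
split; last first.
  move=> [c ->]; apply: ideal_sum => [|j _]; first exact: is_ideal_span.
  by apply: (@ideal_mull _ (ideal_span _)); [exact: is_ideal_span|apply: sub_ideal_span; exists j].
move: a; apply: (@ideal_spanS _ _ [set a | exists c : 'I_d -> A, a = \sum_j c j * x j]).
  split.
  - by exists (fun=> 0); rewrite big1 // => j _; rewrite mul0r.
  - move=> _ _ [a ->] [b ->]; exists (fun j => a j + b j).
    by rewrite -big_split; apply: eq_bigr => j _; rewrite mulrDl.
  - move=> r _ [a ->]; exists (fun j => r * a j).
    by rewrite mulr_sumr; apply: eq_bigr => j _; rewrite mulrA.
move=> _ [j _ <-]; exists (fun k => (k == j)%:R).
rewrite (bigD1 j) //= eqxx mul1r big1 ?addr0 // => k /negbTE ->.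
by rewrite mul0r.
Qed.

Lemma range_codom x : range x = [set` codom x].
Proof.
by apply/seteqP; split=> [_ [j _ <-]|a /codomP [j ->]]; [exact: codom_f|exists j].
Qed.

Lemma idealXB K (a b : A) k : is_ideal K -> K (a - b) -> K (a ^+ k - b ^+ k).
Proof. by move=> iK h; rewrite subrXX; exact: ideal_mulr. Qed.

Lemma is_ideal_radical K : is_ideal K -> is_ideal (ideal_radical K).
Proof.
move=> iK; split.
- by exists 1%N; exact: ideal0.
- move=> a b [k ka] [l lb]; exists (k + l)%N; rewrite exprDn.
  apply: ideal_sum => // i _; rewrite -mulr_natr; apply: ideal_mulr => //.
  have [li|il] := leqP l i.
    by rewrite -(subnK li) exprD mulrA; apply: ideal_mull.
  have -> : (k + l - i = (l - i) + k)%N by lia.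
  by rewrite exprD mulrAC; apply: ideal_mull.
- by move=> r a [k ka]; exists k; rewrite exprMn; exact: ideal_mull.
Qed.

Lemma power_exp_sub x n s : (0 < n)%N ->
  ideal_exp (ideal_span (range (fun j => x j ^+ n))) s `<=`
  ideal_exp (ideal_span (range x)) (n * s).
Proof.
move=> n0; elim: s => [|s IH]; first by rewrite muln0.
rewrite mulnS; apply: ideal_mul_sub; first exact: is_ideal_exp.
move=> a b ha hb; apply: ideal_exp_mul; last exact: IH.
move: a ha; apply: ideal_spanS; first exact: is_ideal_exp.
by move=> _ [j _ <-]; apply: ideal_expX; apply: sub_ideal_span; exists j.
Qed.

(** Each exponent is divided by n: the quotients form [be], and the remainders, each below n, go
    into r. *)
Lemma mono_power (n : nat) (xs : seq A) al : (0 < n)%N -> size al = size xs ->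
  exists be (r : A), [/\ size be = size xs,
    (sumn al <= n * sumn be + n * size xs)%N &
    mono xs al = r * mono [seq z ^+ n | z <- xs] be].
Proof.
move=> n0; elim: xs al => [|x xs IH] [|a al] //=.
  by exists [::], 1; rewrite mulr1.
move=> [/IH [be [r [sbe nbe ->]]]].
exists ((a %/ n)%N :: be), (x ^+ (a %% n) * r); split=> /=; first by rewrite sbe.
  have := divn_eq a n; have := ltn_pmod a n0; nia.
by rewrite {1}(divn_eq a n) exprD mulnC exprM; ring.
Qed.

(** Together with [power_exp_sub] this squeezes the powers of (x_1^n, ..., x_d^n) between powers of
    (x_1, ..., x_d), up to a bounded shift that the leading coefficient ignores. *)
Lemma ideal_exp_power_sup x n s : (0 < n)%N ->
  ideal_exp (ideal_span (range x)) (n * s + n * d) `<=`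
  ideal_exp (ideal_span (range (fun j => x j ^+ n))) s.
Proof.
move=> n0; rewrite !range_codom.
have -> : codom (fun j => x j ^+ n) = [seq z ^+ n | z <- codom x].
  by rewrite (codomE x) -map_comp codomE.
rewrite ideal_exp_mono ideal_exp_mono_le.
apply: mono_span_sub; first exact: is_ideal_mono_span.
move=> al [sal nal]; have [be [r [sbe nbe ->]]] := mono_power n0 sal.
apply: (@ideal_mull _ (mono_span _ _)); first exact: is_ideal_mono_span.
apply: mono_span_in; rewrite /= size_map; split=> //.
have : (n * s <= n * sumn be)%N.
  by move: nbe; rewrite nal size_codom card_ord; lia.
by rewrite leq_pmul2l.
Qed.

End Families.

(** * Concave functions of an integer variable *)

Section Concave.
Variables (f g : nat -> int).
Hypothesis fS : forall k, (0 < k)%N -> f k.+1 = f k + g k.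
Hypothesis g_dec : forall k l, (0 < k)%N -> (k <= l)%N -> g l <= g k.

(** The increment g p bounds the chord slope over [p, k p] from above and that over [1, p] from
    below; denominators are cleared. *)
Lemma concave_mul (k p : nat) : (0 < k)%N -> (0 < p)%N ->
  (p%:Z - 1) * (f (k * p)%N - f p) <= (k%:Z - 1) * p%:Z * (f p - f 1%N).
Proof.
move=> k0 p0.
have up j : f (p + j)%N - f p <= j%:Z * g p.
  elim: j => [|j IH]; first by rewrite addn0 subrr mul0r.
  have := g_dec p0 (leq_addr j p); rewrite addnS fS ?addn_gt0 ?p0 //.
  have -> : j.+1%:Z = j%:Z + 1 by lia.
  by rewrite mulrDl mul1r; move: IH; set u := j%:Z * _; lia.
have low q : q%:Z * g q.+1 <= f q.+1 - f 1%N.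
  elim: q => [|q IH]; first by rewrite mul0r subrr.
  have := g_dec (ltn0Sn q) (leqnSn q.+1); rewrite fS // => h.
  have : q%:Z * g q.+2 <= q%:Z * g q.+1 by apply: ler_wpM2l.
  have -> : q.+1%:Z * g q.+2 = q%:Z * g q.+2 + g q.+2 by lia.
  lia.
case: p p0 up => // q _ up.
have -> : q.+1%:Z - 1 = q%:Z by lia.
case: k k0 => // l _; have -> : l.+1%:Z - 1 = l%:Z by lia.
have q0 : 0 <= q%:Z by [].
rewrite mulSn; apply: (le_trans (ler_wpM2l q0 (up (l * q.+1)%N))).
rewrite mulrCA PoszM; apply: ler_wpM2l => //; exact: low.
Qed.

End Concave.

(** * Multiplicities of parameter ideals *)

Section Multiplicity.
Variable A : comNzRingType.
Variable m : set A.
Hypothesis noethA : noetherian_ring A.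
Hypothesis locA : local_ring m.
Variable d : nat.
Implicit Types (x : 'I_d -> A) (i j : 'I_d) (J K : set A).

Let im : is_ideal m := local_ideal locA.

Lemma local_exp a k : m (a ^+ k) -> m a.
Proof.
move=> h; apply: contrapT => /(local_inv noethA locA) [b hb].
apply: (local_proper locA); rewrite -(expr1n _ k) -hb exprMn.
exact: ideal_mull.
Qed.

Local Notation sop := (@system_of_parameters A m d).

Lemma sopP x : sop x <-> [/\ d = krull_dim A, forall j, m (x j) &
  forall y, m y -> ideal_radical (ideal_span (range x)) y].
Proof.
split=> [[dE radE]|[dE xm rad]]; split=> //.
- move=> j; rewrite -radE; exists 1%N; apply: sub_ideal_span.
  by rewrite expr1; exists j.
- by move=> y; rewrite -radE.
- apply/seteqP; split=> // a [k ka]; apply: (@local_exp _ k); move: ka.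
  by apply: ideal_spanS => // _ [j _ <-].
Qed.

Lemma sop_dim x : sop x -> d = krull_dim A.
Proof. by case/sopP. Qed.

Lemma sop_in x j : sop x -> m (x j).
Proof. by case/sopP. Qed.

Lemma sop_radical x y : sop x -> m y -> ideal_radical (ideal_span (range x)) y.
Proof. by case/sopP => _ _; apply. Qed.

Lemma sop_sub x (y : 'I_d -> A) : sop x -> (forall j, m (y j)) ->
  (forall j, ideal_radical (ideal_span (range y)) (x j)) -> sop y.
Proof.
move=> sx ym xr; apply/sopP; split=> //; first exact: sop_dim sx.
have iR : is_ideal (ideal_radical (ideal_span (range y))).
  by apply: is_ideal_radical; exact: is_ideal_span.
move=> z /(sop_radical sx) [k zk].
have [l hl] : ideal_radical (ideal_span (range y)) (z ^+ k).
  by move: zk; apply: ideal_spanS => // _ [j _ <-].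
by exists (k * l)%N; rewrite exprM.
Qed.

Lemma sop_exp x (n : 'I_d -> nat) : sop x -> (forall j, (0 < n j)%N) ->
  sop (fun j => x j ^+ n j).
Proof.
move=> sx n0; apply: (sop_sub sx) => j.
  have := n0 j; case: (n j) => // k _; rewrite exprS.
  by apply: ideal_mulr => //; exact: sop_in sx.
by exists (n j); apply: sub_ideal_span; exists j.
Qed.

Lemma sop_upd x i z : sop x -> m z ->
  ideal_radical (addp (others x i) z) (x i) -> sop (upd x i z).
Proof.
move=> sx mz rz; apply: (sop_sub sx) => j.
  by rewrite /upd; case: eqP => // _; exact: sop_in sx.
rewrite ideal_span_upd; have [->//|ji] := eqVneq j i.
by exists 1%N; rewrite expr1; apply: addp_sub; exact: others_in.
Qed.

Lemma sop_upd_exp x i k : sop x -> (0 < k)%N -> sop (upd x i (x i ^+ k)).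
Proof.
move=> sx k0; apply: sop_upd => //.
  case: k k0 => // k _; rewrite exprS; apply: ideal_mulr => //; exact: sop_in sx.
by exists k; apply: addp_id; exact: is_ideal_others.
Qed.

Lemma finite_length_sop x : sop x -> finite_length (ideal_span (range x)).
Proof.
move=> sx; apply: (finite_length_primary noethA locA); first exact: is_ideal_span.
by move=> y; exact: sop_radical.
Qed.

Lemma finite_length_sop_sup x K : sop x -> is_ideal K ->
  (forall j, K (x j)) -> finite_length K.
Proof.
move=> sx iK hK; apply: (finite_length_sub _ iK _ (finite_length_sop sx)).
  exact: is_ideal_span.
by apply: ideal_spanS => // _ [j _ <-].
Qed.

Lemma finite_length_sop_exp x n : sop x ->
  finite_length (ideal_exp (ideal_span (range x)) n.+1).
Proof.
move=> sx; rewrite range_codom.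
by apply: (proj1 (quotient_length_ideal_exp _ n)); rewrite -range_codom; exact: finite_length_sop.
Qed.

Lemma hilbert_coefs_sop x : sop x ->
  exists e, hilbert_coefs (ideal_span (range x)) e.
Proof.
move=> sx; have := @eventually_poly_quotient_length _ (codom x).
rewrite -range_codom => /(_ (finite_length_sop sx)) /eventually_poly_hilbert.
rewrite size_codom card_ord => -[e [N h]]; exists e.
by rewrite /hilbert_coefs -(sop_dim sx); exists N.
Qed.

Lemma multiplicityE (Q : set A) e : hilbert_coefs Q e -> multiplicity Q = e 0%N.
Proof.
have le e1 e2 : hilbert_coefs Q e1 -> hilbert_coefs Q e2 -> e1 0%N <= e2 0%N.
  move=> h1 h2; have := @hilbert_leading_le e1 e2 (krull_dim A) 1 0 1 0 _ _ h1 h2.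
  by rewrite expr1n !mulr1; apply => //; exists 0%N.
move=> he; apply: xget_unique; first by exists e.
move=> _ [e' [he' <-]]; apply/eqP; rewrite eq_le; apply/andP.
by split; apply: le.
Qed.

Local Notation mult x := (multiplicity (ideal_span (range x))).
Local Notation len x := (quotient_length (ideal_span (range x))).

Lemma mult_ge0 x : sop x -> 0 <= mult x.
Proof.
move=> sx; have [e he] := hilbert_coefs_sop sx; rewrite (multiplicityE he).
exact: hilbert_leading_ge0 he _.
Qed.

Lemma mult_power x n : sop x -> (0 < n)%N ->
  mult (fun j => x j ^+ n) = n%:Z ^+ d * mult x.
Proof.
move=> sx n0; have sn : sop (fun j => x j ^+ n) by exact: (@sop_exp x (fun=> n)).
have [e he] := hilbert_coefs_sop sx; have [e' he'] := hilbert_coefs_sop sn.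
rewrite (multiplicityE he) (multiplicityE he').
apply/eqP; rewrite eq_le mulrC; apply/andP; split.
  have := @hilbert_leading_le e' e (krull_dim A) 1 0 n (n * d + n).-1 _ _ he' he.
  rewrite expr1n mulr1 -(sop_dim sx); apply => //; exists 0%N => k _.
  rewrite lez_nat; apply: quotient_length_le; try exact: is_ideal_exp.
    have -> : (n * k + (n * d + n).-1).+1 = (n * k.+1 + n * d)%N by lia.
    by rewrite mul1n addn0; exact: ideal_exp_power_sup.
  exact: finite_length_sop_exp.
have := @hilbert_leading_le e e' (krull_dim A) n n.-1 1 0 _ _ he he'.
rewrite expr1n mulr1 -(sop_dim sx); apply => //; exists 0%N => k _.
rewrite lez_nat; apply: quotient_length_le; try exact: is_ideal_exp.
  have -> : (n * k + n.-1).+1 = (n * k.+1)%N by lia.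
  by rewrite mul1n addn0; exact: power_exp_sub.
exact: finite_length_sop_exp.
Qed.

Lemma multiplicity_le_sop x : sop x -> 0 < multiplicity m ->
  multiplicity m <= mult x.
Proof.
move=> sx m0; have [e' he'] := hilbert_coefs_sop sx; rewrite (multiplicityE he').
(* A positive value is not the default 0 of [multiplicity], so m does have Hilbert coefficients. *)
have [e he] : exists e, hilbert_coefs m e.
  apply: contrapT => ne; move: m0; rewrite /multiplicity xgetPN ?ltxx //.
  by move=> c [e [he _]]; apply: ne; exists e.
rewrite (multiplicityE he).
have := @hilbert_leading_le e e' (krull_dim A) 1 0 1 0 _ _ he he'.
rewrite expr1n !mulr1; apply => //; exists 0%N => k _.
rewrite lez_nat; apply: quotient_length_le; try exact: is_ideal_exp.
  rewrite !mul1n; apply: ideal_expS; apply: ideal_spanS => // _ [j _ <-].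
  exact: sop_in sx.
by rewrite !mul1n; exact: finite_length_sop_exp.
Qed.

End Multiplicity.

(** * Colon ideals in Buchsbaum rings *)

Section Buchsbaum.
Variable A : comNzRingType.
Variable m : set A.
Hypothesis hA : buchsbaum_local_ring m.
Variable d : nat.
Implicit Types (x : 'I_d -> A) (i j : 'I_d) (J K : set A).

Let noethA : noetherian_ring A. Proof. by case: hA. Qed.
Let locA : local_ring m. Proof. by case: hA. Qed.
Let im : is_ideal m := local_ideal locA.

Local Notation sop := (@system_of_parameters A m d).
Local Notation mult x := (multiplicity (ideal_span (range x))).
Local Notation len x := (quotient_length (ideal_span (range x))).

Lemma len_mult x (y : 'I_d -> A) : sop x -> sop y ->
  (len x)%:Z - mult x = (len y)%:Z - mult y.
Proof. by move=> sx sy; case: hA => _ _ _; apply; [exists d, x|exists d, y]. Qed.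

Lemma addp_colp_exp J z k : is_ideal J ->
  colp (addp J (z ^+ k.+1)) (z ^+ k) = addp (colp J (z ^+ k)) z.
Proof.
move=> iJ; apply/seteqP; split=> a [r hr]; exists r; move: hr; rewrite /colp /=.
  by rewrite exprS mulrBl mulrA.
by rewrite exprS mulrBl mulrA.
Qed.

Lemma addp_addp_exp J z k : is_ideal J ->
  addp (addp J (z ^+ k.+1)) (z ^+ k) = addp J (z ^+ k).
Proof.
move=> iJ; have ia := is_ideal_addp (z ^+ k) iJ; apply/seteqP; split.
  apply: addp_min => //; last exact: addp_id.
  by apply: addp_min => //; [exact: addp_sub|rewrite exprS; exact: addp_gen].
by apply: addpS; exact: addp_sub.
Qed.

(** As J : z^k grows with k, the second summand does not increase; this is the source of concavity
    in the exponent. *)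
Lemma quotient_length_exp J z k : is_ideal J -> finite_length (addp J (z ^+ k.+1)) ->
  quotient_length (addp J (z ^+ k.+1)) =
  (quotient_length (addp J (z ^+ k)) + quotient_length (addp (colp J (z ^+ k)) z))%N.
Proof.
move=> iJ fin; have ia := is_ideal_addp (z ^+ k.+1) iJ.
rewrite (quotient_length_addp (x := z ^+ k)) // ?addp_addp_exp ?addp_colp_exp //.
  rewrite -(addp_addp_exp z k iJ); apply: finite_length_sub fin => //.
    exact: is_ideal_addp.
  exact: addp_sub.
rewrite -(addp_colp_exp z k iJ); apply: finite_length_sub fin => //.
  exact: is_ideal_colp.
exact: colp_sub.
Qed.

Lemma finite_length_colp x i k : sop x ->
  finite_length (addp (colp (others x i) (x i ^+ k)) (x i)).
Proof.
move=> sx; have io := is_ideal_others x i.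
have ic := is_ideal_colp (x i ^+ k) io.
apply: (finite_length_sop_sup noethA locA sx) => [|j]; first exact: is_ideal_addp.
have [->|ji] := eqVneq j i; first exact: addp_id.
by apply: addp_sub; apply: colp_sub => //; exact: others_in.
Qed.

Lemma len_upd_exp x i k : sop x -> (0 < k)%N ->
  len (upd x i (x i ^+ k.+1)) = (len (upd x i (x i ^+ k)) +
    quotient_length (addp (colp (others x i) (x i ^+ k)) (x i)))%N.
Proof.
move=> sx k0; rewrite !ideal_span_upd quotient_length_exp //.
  exact: is_ideal_others.
rewrite -ideal_span_upd; apply: (finite_length_sop noethA locA).
exact: (sop_upd_exp noethA locA).
Qed.

Lemma quotient_length_colp_exp_le x i k l : sop x -> (k <= l)%N ->
  (quotient_length (addp (colp (others x i) (x i ^+ l)) (x i)) <=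
   quotient_length (addp (colp (others x i) (x i ^+ k)) (x i)))%N.
Proof.
move=> sx kl; have io := is_ideal_others x i.
apply: quotient_length_le; try by apply: is_ideal_addp; exact: is_ideal_colp.
  by apply: addpS; exact: colp_exp_le.
exact: finite_length_colp.
Qed.

(* The lengths L(n) of the quotients by powers x^n of a system of parameters are
   concave in each n_i and differ by a constant from the multiplicities, which
   are homogeneous of degree d in n; a nonnegative concave function on the
   positive reals grows at most linearly. *)
Lemma mult_upd_le x i k : sop x -> (0 < k)%N ->
  mult (upd x i (x i ^+ k)) <= k%:Z * mult x.
Proof.
move=> sx k0; set M := mult x; set Mk := mult _.
have sk := sop_upd_exp noethA locA i sx k0.
have M0 : 0 <= M by exact: (mult_ge0 noethA locA).
rewrite leNgt; apply/negP => lt.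
(* N exceeds (k - 1) M + 1, against the final inequality N - 1 <= (k - 1) M. *)
pose N := (absz ((k%:Z - 1) * M)%R).+2.
(* Only the entries other than the i-th are raised to the power N: the exponents N and k N at i then
   give the N-th powers of x and of [upd x i (x i ^+ k)]. *)
pose w j := x j ^+ (if j == i then 1 else N)%N.
have sw : sop w by apply: (sop_exp noethA locA) => // j; case: ifP.
pose f l := (len (upd w i (w i ^+ l)))%:Z.
pose g l := (quotient_length (addp (colp (others w i) (w i ^+ l)) (w i)))%:Z.
have fS l : (0 < l)%N -> f l.+1 = f l + g l.
  by move=> l0; rewrite /f len_upd_exp // PoszD.
have g_dec l l' : (0 < l)%N -> (l <= l')%N -> g l' <= g l.
  by move=> _ ll'; rewrite lez_nat; exact: quotient_length_colp_exp_le.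
have := concave_mul fS g_dec k0 (ltn0Sn _ : (0 < N)%N).
have fE l : (0 < l)%N -> f l = mult (upd w i (w i ^+ l)) + ((len x)%:Z - M).
  move=> l0; have sl := sop_upd_exp noethA locA i sw l0.
  by rewrite (len_mult sx sl) -/(f l) addrC subrK.
rewrite !fE ?muln_gt0 ?k0 //.
have -> : upd w i (w i ^+ N) = fun j => x j ^+ N.
  by apply/funext => j; rewrite /upd /w eqxx expr1; case: eqP => // ->.
have -> : upd w i (w i ^+ (k * N)) = fun j => upd x i (x i ^+ k) j ^+ N.
  by apply/funext => j; rewrite /upd /w eqxx expr1 exprM; case: eqP.
rewrite !(mult_power noethA locA) // -/M -/Mk.
(* In the concavity inequality M1 >= 0 is dropped, the constant c cancels, and the factor P = N^d is
   divided out. *)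
have := mult_ge0 noethA locA (sop_upd_exp noethA locA i sw (ltn0Sn 0)).
set M1 := mult _ => M1_ge0; set c := _ - M; set P := N%:Z ^+ d => h.
have P0 : 0 < P by rewrite exprn_gt0.
have : P * ((N%:Z - 1) * (Mk - M)) <= P * ((k%:Z - 1) * N%:Z * M).
  have -> : P * ((N%:Z - 1) * (Mk - M)) = (N%:Z - 1) * (P * Mk + c - (P * M + c)) by ring.
  apply: (le_trans h); have -> : P * ((k%:Z - 1) * N%:Z * M) = (k%:Z - 1) * N%:Z * (P * M) by ring.
  apply: ler_wpM2l; last by move: (P * M) => u; lia.
  by apply: mulr_ge0 => //; lia.
rewrite ler_pM2l // => h'.
have : (N%:Z - 1) * ((k%:Z - 1) * M + 1) <= (k%:Z - 1) * N%:Z * M.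
  apply: le_trans h'; apply: ler_wpM2l => //.
  by move: lt; rewrite mulrBl mul1r; set u := _ * M; lia.
have : (k%:Z - 1) * M <= N%:Z - 2.
  by rewrite /N; have := ler_norm ((k%:Z - 1) * M); lia.
have -> : (k%:Z - 1) * N%:Z * M = N%:Z * ((k%:Z - 1) * M) by ring.
move: ((k%:Z - 1) * M) => u.
have -> : (N%:Z - 1) * (u + 1) = N%:Z * u + (N%:Z - u - 1) by ring.
by move: (N%:Z * u) => v; lia.
Qed.

(** Raising the other d - 1 entries to the power k as well multiplies by at most k^(d-1), while the
    total factor is k^d by homogeneity; so the i-th entry contributes at least k. *)
Lemma mult_upd x i k : sop x -> (0 < k)%N ->
  mult (upd x i (x i ^+ k)) = k%:Z * mult x.
Proof.
move=> sx k0; apply/eqP; rewrite eq_le mult_upd_le //=.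
pose y (s : seq 'I_d) j := x j ^+ (if j \in s then k else 1)%N.
have sy s : sop (y s) by apply: (sop_exp noethA locA) => // j; case: ifP.
have yS j s : j \notin s -> y (j :: s) = upd (y s) j (y s j ^+ k).
  move=> js; apply/funext => l; rewrite /y /upd inE.
  by case: eqP => [->|_] //=; rewrite (negbTE js) expr1.
have step s t : uniq (s ++ t) -> mult (y (s ++ t)) <= k%:Z ^+ size s * mult (y t).
  elim: s => [|j s IH] /=; first by rewrite expr0 mul1r.
  move=> /andP [js /IH h]; rewrite yS //.
  apply: (le_trans (mult_upd_le _ (sy _) k0)).
  by rewrite exprS -mulrA; apply: ler_wpM2l.
have yi : y [:: i] = upd x i (x i ^+ k).
  by apply/funext => j; rewrite /y /upd inE; case: eqP => [->|].
have := step (enum (predC1 i)) [:: i]; rewrite yi cats1 rcons_uniq mem_enum inE eqxx.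
rewrite enum_uniq => /(_ isT).
have -> : y (rcons (enum (predC1 i)) i) = fun j => x j ^+ k.
  apply/funext => j; rewrite /y mem_rcons inE mem_enum inE.
  by case: eqVneq.
rewrite (mult_power noethA locA) // -cardE cardC1 card_ord.
have d0 : (0 < d)%N by exact: leq_ltn_trans (ltn_ord i).
have -> : k%:Z ^+ d = k%:Z ^+ d.-1 * k%:Z by rewrite -exprSr prednK.
have k0' : 0 < k%:Z ^+ d.-1 by rewrite exprn_gt0.
by rewrite -mulrA ler_pM2l.
Qed.

(** With x_i^l in place of x_i, the length is l e(x) plus a constant, so every increment in
    [len_upd_exp] equals e(x). *)
Lemma mult_quotient_length x i k : sop x -> (0 < k)%N ->
  mult x = (quotient_length (addp (colp (others x i) (x i ^+ k)) (x i)))%:Z.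
Proof.
move=> sx k0.
have h l : (0 < l)%N -> (len (upd x i (x i ^+ l)))%:Z = l%:Z * mult x + ((len x)%:Z - mult x).
  move=> l0; have sl := sop_upd_exp noethA locA i sx l0.
  by rewrite (len_mult sx sl) mult_upd // addrC subrK.
have := h _ (ltn0Sn k); rewrite len_upd_exp // PoszD h //.
have -> : k.+1%:Z = k%:Z + 1 by lia.
by rewrite mulrDl mul1r; set u := _ * _; lia.
Qed.

(** The ideals (J : x_i^l) + (x_i), l >= 1, are nested of equal colength, hence coincide. For a
    stable exponent K, the inclusion of J : x_i^K in J : x_i^l is then brought down to l = 1. *)
Lemma colp_exp_sub x i k : sop x ->
  colp (others x i) (x i ^+ k) `<=` colp (others x i) (x i).
Proof.
move=> sx; set J := others x i; have iJ : is_ideal J by exact: is_ideal_others.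
have [K hK] := colp_exp_stable noethA (x i) iJ.
have ic l := is_ideal_colp (x i ^+ l) iJ.
have e1 : colp J (x i) = colp J (x i ^+ 1) by rewrite expr1.
have add l : (0 < l)%N -> colp J (x i ^+ l) `<=` addp (colp J (x i)) (x i).
  move=> l0; rewrite e1.
  have sub : addp (colp J (x i ^+ l)) (x i) `<=` addp (colp J (x i ^+ 1)) (x i).
    apply: quotient_length_eq; try exact: is_ideal_addp.
    - by apply: addpS; exact: colp_exp_le.
    - exact: finite_length_colp.
    - by apply/eqP; rewrite -eqz_nat -!mult_quotient_length.
  by apply: subset_trans sub; exact: addp_sub.
suff h l : (0 < l)%N -> colp J (x i ^+ K) `<=` colp J (x i ^+ l) ->
    colp J (x i ^+ K) `<=` colp J (x i ^+ 1).
  have [K0|K0] := posnP K; last first.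
    by rewrite e1; apply: subset_trans (hK k) (h K K0 _).
  rewrite e1.
  by apply: subset_trans (hK k) (colp_exp_le _ _) => //; rewrite K0.
elim: l => // -[_ _ //|l] IH _ hl; apply: IH => // z Kz.
have K0 : (0 < l.+1)%N by [].
have [r hr] : addp (colp J (x i)) (x i) z by apply: (@add l.+2) => //; exact: hl.
(* Write z = s + r x_i with s in J : x_i. Then r lies in J : x_i^(l+3), hence in J : x_i^K by
   stability, so r x_i^(l+2) and z x_i^(l+1) lie in J. *)
have Kr : colp J (x i ^+ K) r.
  apply: (hK (l.+3)); rewrite /colp /=.
  have -> : r * x i ^+ l.+3 = z * x i ^+ l.+2 - (z - r * x i) * x i * x i ^+ l.+1.
    by rewrite !exprS; ring.
  by apply: idealB => //; [exact: hl|apply: ideal_mulr].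
rewrite /colp /=.
have -> : z * x i ^+ l.+1 = r * x i ^+ l.+2 + (z - r * x i) * x i * x i ^+ l.
  by rewrite !exprS; ring.
by apply: idealD => //; [exact: hl|apply: ideal_mulr].
Qed.

(** Some z^k lies in J + (x_i), so J : x_i is contained in J : z^k, which [colp_exp_sub] reduces to
    J : z. *)
Lemma colp_sop x i z : sop x -> sop (upd x i z) ->
  colp (others x i) (x i) `<=` colp (others x i) z.
Proof.
move=> sx sz; set J := others x i; have iJ : is_ideal J by exact: is_ideal_others.
have mz : m z by have := sop_in noethA locA i sz; rewrite upd_same.
have [k] := sop_radical noethA locA sx mz.
rewrite (ideal_span_range _ i) -/J => -[r hr] a Ja.
have := @colp_exp_sub _ i k sz; rewrite upd_same others_upd -/J; apply.
rewrite /colp /=.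
have -> : a * z ^+ k = a * (z ^+ k - r * x i) + r * (a * x i) by ring.
by apply: idealD => //; exact: ideal_mull.
Qed.


(* A Fitting-type decomposition with respect to y of the Artinian ring obtained
   from A/J by inverting x. *)
Lemma sop_fitting x i y : sop x -> m y ->
  exists N M b, others x i ((x i ^+ M - y * b) * y ^+ N).
Proof.
move=> sx my; set J := others x i; have iJ : is_ideal J by exact: is_ideal_others.
(* [S k] is the contraction to A of the ideal that J and y^k generate after inverting x_i. *)
pose S k : set A := [set a | exists M, addp J (y ^+ k) (a * x i ^+ M)].
have ia k : is_ideal (addp J (y ^+ k)) by exact: is_ideal_addp.
have iS k : is_ideal (S k).
  split.
  - by exists 0%N; rewrite mul0r; exact: ideal0.
  - move=> a b [M hM] [L hL]; exists (M + L)%N; rewrite mulrDl; apply: idealD => //.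
      by rewrite exprD mulrA; exact: ideal_mulr.
    by rewrite addnC exprD mulrA; exact: ideal_mulr.
  - by move=> r a [M hM]; exists M; rewrite -mulrA; exact: ideal_mull.
have SS k : S k.+1 `<=` S k.
  move=> a [M [r hr]]; exists M, (r * y); move: hr.
  by rewrite exprS mulrA.
have JS k : J `<=` S k by move=> a Ja; exists 0%N; rewrite mulr1; exact: addp_sub.
have [|||||N hN] := @finite_length_dcc _ (ideal_span (range x)) (fun k => addp (S k) (x i)).
- exact: is_ideal_span.
- exact: (finite_length_sop noethA locA).
- by move=> k; exact: is_ideal_addp.
- by move=> k; rewrite (ideal_span_range _ i); apply: addpS; exact: JS.
- by move=> k; apply: addpS; exact: SS.
(* The chain is known to stop only after adding x_i. As [S k] is saturated with respect to x_i,
   [S N] equals [S N.+1] + x_i [S N], and Nakayama applies. *)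
have SN : S N `<=` S N.+1.
  apply: (nakayama noethA locA) => // s Ss.
  have [r hr] : addp (S N.+1) (x i) s by apply: hN; exact: addp_sub.
  exists (s - r * x i), r; split=> //; last first.
    by exists (x i); [exact: (sop_in noethA locA)|ring].
  have [M hM] : S N (r * x i).
    have -> : r * x i = s - (s - r * x i) by ring.
    by apply: idealB => //; exact: SS.
  by exists M.+1; rewrite exprS mulrA.
have [M [b hb]] : S N.+1 (y ^+ N).
  by apply: SN; exists 0%N; rewrite mulr1; exact: addp_id.
exists N, M, b; rewrite mulrBl; move: hb; rewrite exprS.
by have -> : y ^+ N * x i ^+ M - b * (y * y ^+ N) = x i ^+ M * y ^+ N - y * b * y ^+ N by ring.
Qed.

(* For y in m there is a multiple w of x_i such that x_i can be replaced by y + w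
   in the system of parameters; both x_i and y + w multiply J : x_i into J. *)
Lemma colp_socle x i a y : sop x ->
  colp (others x i) (x i) a -> m y -> others x i (a * y).
Proof.
move=> sx; set J := others x i => Ja my.
have iJ : is_ideal J by exact: is_ideal_others.
have [N [M [b hb]]] := sop_fitting i sx my; rewrite -/J in hb.
(* Modulo J, w' kills y^N because x_i^M - y b does; it differs from a power of x_i by a multiple of
   y^(N+1). *)
pose w' := (x i ^+ M) ^+ N.+1 - (y * b) ^+ N.+1.
have hw' : J (w' * y ^+ N).
  exact: (idealXB (K := colp J (y ^+ N)) N.+1 (is_ideal_colp _ iJ) hb).
pose z := y + w' * x i.
have mx : m (x i) by exact: (sop_in noethA locA).
have mz : m z by apply: idealD => //; exact: ideal_mull.
have iK : is_ideal (addp J z) by exact: is_ideal_addp.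
have yK : addp J z (y ^+ N.+1).
  have -> : y ^+ N.+1 = y ^+ N * z - x i * (w' * y ^+ N).
    by rewrite /z exprS; ring.
  by apply: idealB => //; [exact: addp_gen|apply: addp_sub; exact: ideal_mull].
have sz : sop (upd x i z).
  apply: (sop_upd noethA locA) => //; rewrite -/J.
  (* Modulo J + (z), which contains y^(N+1), some power of x_i equals - y, so a further power
     vanishes. *)
  exists ((M * N.+1).+1 * N.+1)%N; rewrite exprM.
  apply: (idealBP iK (b := (- y) ^+ N.+1)); last first.
    by rewrite exprNn; exact: ideal_mull.
  apply: idealXB => //.
  have -> : x i ^+ (M * N.+1).+1 - - y = z + x i * b ^+ N.+1 * y ^+ N.+1.
    by rewrite /z /w' exprSr exprM exprMn; ring.
  by apply: idealD => //; [exact: addp_id|exact: ideal_mull].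
have Jz : J (a * z) by exact: (colp_sop sx sz).
have -> : a * y = a * z - w' * (a * x i) by rewrite /z; ring.
by apply: idealB => //; exact: ideal_mull.
Qed.

Hypothesis he : 1 < multiplicity m.

Lemma maximal_not_sub x i : sop x ->
  ~ (m `<=` addp (colp (others x i) (x i)) (x i)).
Proof.
move=> sx mJ; move: he; apply/negP; rewrite -leNgt.
have m0 : 0 < multiplicity m by exact: lt_trans he.
apply: (le_trans (multiplicity_le_sop noethA locA sx m0)).
rewrite (@mult_quotient_length _ i 1) // expr1 lez_nat.
have hm := has_length_maximal (local_maximal locA).
rewrite -(quotient_lengthE hm); apply: quotient_length_le => //; last by exists 1%N.
by apply: is_ideal_addp; apply: is_ideal_colp; exact: is_ideal_others.
Qed.

Lemma maximal_not_sub_others x i : sop x -> ~ (m `<=` others x i).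
Proof.
move=> sx mJ; apply: (maximal_not_sub (i := i) sx); apply: (subset_trans mJ).
apply: subset_trans (@addp_sub _ _ _).
by apply: colp_sub; exact: is_ideal_others.
Qed.

Lemma others_sub_span x i : others x i `<=` ideal_span (range x).
Proof. by rewrite (ideal_span_range _ i); exact: addp_sub. Qed.

(* [mI = mQ] for [I = Q : m]. *)
Lemma colon_mul_maximal x z y : sop x ->
  ideal_colon (ideal_span (range x)) m z -> m y ->
  exists t : 'I_d -> A, (forall j, m (t j)) /\ z * y = \sum_j t j * x j.
Proof.
move=> sx Iz my; have /ideal_span_rangeP [c hc] := Iz y my.
(* If c_i were a unit, x_i would be a multiple of z y modulo J, so y and z y could each replace x_i.
   Every w in m would then lie in (J : y) + (y), against [maximal_not_sub]. *)
exists c; split=> // i; apply: contrapT => /(local_inv noethA locA) [u uc].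
set J := others x i; have iJ : is_ideal J by exact: is_ideal_others.
have [e Je hx] : exists2 e, J e & x i = u * (z * y) + e.
  exists (- u * \sum_(j < d | j != i) c j * x j).
    by apply: ideal_mull => //; exists c.
  rewrite hc (bigD1 i) //= -[LHS]mul1r -uc; ring.
have sub t : J `<=` addp J t by exact: addp_sub.
have sy : sop (upd x i y).
  apply: (sop_upd noethA locA) => //; exists 1%N; rewrite expr1 -/J hx.
  have ia := is_ideal_addp y iJ.
  by apply: idealD => //; [rewrite mulrA; exact: addp_gen|exact: sub].
have szy : sop (upd x i (z * y)).
  apply: (sop_upd noethA locA) => //; first exact: ideal_mull.
  exists 1%N; rewrite expr1 -/J hx; have ia := is_ideal_addp (z * y) iJ.
  by apply: idealD => //; [exact: addp_gen|exact: sub].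
apply: (maximal_not_sub (i := i) sy); rewrite others_upd upd_same -/J => w mw.
have := Iz w mw; rewrite (ideal_span_range _ i) -/J => -[r hr].
have hz : J ((w - r * u * y) * z).
  have -> : (w - r * u * y) * z = (z * w - r * x i) + r * e by rewrite hx; ring.
  by apply: idealD => //; exact: ideal_mull.
exists (r * u); rewrite /colp /=.
rewrite -[J](others_upd x i (z * y)); apply: colp_socle => //.
by rewrite others_upd upd_same /colp /= mulrA; exact: ideal_mulr.
Qed.

(** Each b_j multiplies x_j into the ideal of the other parameters, so m carries b_j into that
    ideal; a unit b_j would put m inside it, which e(A) > 1 excludes. *)
Lemma colp_syzygy x i w : sop x -> colp (others x i) (x i) w ->
  exists b : 'I_d -> A, [/\ w * x i = \sum_(j < d | j != i) b j * x j,
    forall j, j != i -> m (b j) &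
    forall j t, j != i -> m t -> others x j (b j * t)].
Proof.
move=> sx [b hb]; exists b.
have h j t : j != i -> m t -> others x j (b j * t).
  move=> ji; apply: colp_socle => //; have io := is_ideal_others x j.
  rewrite /colp /=; have -> : b j * x j =
      w * x i - \sum_(k < d | (k != i) && (k != j)) b k * x k.
    by rewrite hb (bigD1 j) //= addrK.
  apply: idealB => //; first by apply: ideal_mull => //; apply: others_in; rewrite eq_sym.
  apply: ideal_sum => // k /andP [_ kj]; apply: ideal_mull => //; exact: others_in.
split=> // j ji; apply: contrapT => /(local_inv noethA locA) [u ub].
apply: (maximal_not_sub_others (i := j) sx) => t mt.
have -> : t = u * (b j * t) by rewrite mulrA ub mul1r.
by apply: ideal_mull; [exact: is_ideal_others|exact: h].
Qed.

End Buchsbaum.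

(** * The ideal Q : m *)

Section SocleIdeal.
Variable A : comNzRingType.
Variable m : set A.
Hypothesis hA : buchsbaum_local_ring m.
Hypothesis he : 1 < multiplicity m.
Variable d : nat.
Implicit Types (i j : 'I_d).

Let noethA : noetherian_ring A. Proof. by case: hA. Qed.
Let locA : local_ring m. Proof. by case: hA. Qed.
Let im : is_ideal m := local_ideal locA.

(** Here q is the system of powers. Only its i-th entry is displayed as a power, with exponent N = n
    + 2, which encodes N >= 2. *)
Variables (q : 'I_d -> A) (i : 'I_d) (x : A) (n : nat).
Hypothesis sq : system_of_parameters m q.
Hypothesis mx : m x.
Hypothesis qi : q i = x ^+ n.+2.

Let J := others q i.
Let W := colp J x.
Let Q := ideal_span (range q).
Let I := ideal_colon Q m.
Let iJ : is_ideal J. Proof. exact: is_ideal_others. Qed.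
Let iW : is_ideal W. Proof. exact: is_ideal_colp. Qed.
Let iQ : is_ideal Q. Proof. exact: is_ideal_span. Qed.
Let iI : is_ideal I. Proof. exact: is_ideal_colon. Qed.
Let iQI : is_ideal (ideal_mul Q I). Proof. exact: is_ideal_span. Qed.
Let QE : Q = addp J (x ^+ n.+2). Proof. by rewrite /Q (ideal_span_range _ i) qi. Qed.
Let JQ : J `<=` Q. Proof. by rewrite QE; exact: addp_sub. Qed.

Let sop_x : system_of_parameters m (upd q i x).
Proof.
apply: (sop_upd noethA locA) => //; exists 1%N; rewrite expr1 qi exprS mulrC.
by apply: addp_gen; exact: iJ.
Qed.

Let W_mul a y : W a -> m y -> J (a * y).
Proof.
move=> Wa my; rewrite /J -(others_upd q i x).
by apply: (colp_socle hA sop_x) => //; rewrite others_upd upd_same.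
Qed.

Let W_exp a k : J (a * x ^+ k) -> W a.
Proof.
move=> h; have := @colp_exp_sub _ _ hA _ (upd q i x) i k sop_x.
by rewrite others_upd upd_same; apply.
Qed.

Let W_sub_max : W `<=` m.
Proof.
move=> a Wa; apply: contrapT => /(local_inv noethA locA) [u ua].
apply: (maximal_not_sub_others hA he (i := i) sop_x) => y my.
rewrite others_upd -[y]mul1r -ua -mulrA; apply: ideal_mull => //; exact: W_mul.
Qed.

Let W_sub_I : W `<=` I.
Proof. by move=> a Wa y my; apply: JQ; exact: W_mul. Qed.

Let I_decomp z : I z -> exists a, W (z - x ^+ n.+1 * a).
Proof.
move=> /(_ x mx); rewrite QE => -[a ha]; exists a; rewrite /W /colp /=.
by have -> : (z - x ^+ n.+1 * a) * x = z * x - a * x ^+ n.+2 by rewrite (exprS x n.+1); ring.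
Qed.

(** By mI = mQ the coefficient t of x^N in x^(N-1) a y lies in m; then (a y - x t) x^(N-1) lies in
    J, and [W_exp] removes the power of x. *)
Let top_mul a y : I (x ^+ n.+1 * a) -> m y -> exists2 t, m t & W (a * y - x * t).
Proof.
move=> Ia my; have [t [mt ht]] := colon_mul_maximal hA he sq Ia my.
exists (t i) => //; apply: (@W_exp _ n.+1).
have -> : (a * y - x * t i) * x ^+ n.+1 = \sum_(j < d | j != i) t j * q j.
  have := ht; rewrite (bigD1 i) //= qi => /(canLR (addKr _)) <-.
  by rewrite (exprS x n.+1); ring.
by exists t.
Qed.

Let top_max a : I (x ^+ n.+1 * a) -> m a.
Proof.
move=> Ia; apply: contrapT => /(local_inv noethA locA) [u ua].
apply: (maximal_not_sub hA he (i := i) sop_x) => y my.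
rewrite others_upd upd_same; have [t mt ht] := top_mul Ia my.
exists (u * t); have -> : y - u * t * x = u * (a * y - x * t).
  by rewrite -[y in LHS]mul1r -ua; ring.
exact: ideal_mull.
Qed.

(** Since N >= 2, the product is x^N times x^(N-2) a b; [top_mul] and [top_max] place the second
    factor in I. *)
Let top_top a b : I (x ^+ n.+1 * a) -> I (x ^+ n.+1 * b) ->
  ideal_mul Q I (x ^+ n.+1 * a * (x ^+ n.+1 * b)).
Proof.
move=> Ia Ib.
have -> : x ^+ n.+1 * a * (x ^+ n.+1 * b) = x ^+ n.+2 * (x ^+ n * a * b).
  by rewrite !exprS; ring.
apply: ideal_mul_in; first by rewrite QE; exact: addp_id.
move=> y my; have [t mt ht] := top_mul Ia my.
have -> : x ^+ n * a * b * y = x ^+ n * ((a * y - x * t) * b) + x ^+ n.+1 * b * t.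
  by rewrite exprS; ring.
apply: (@idealD _ Q) => //; last exact: Ib.
by apply: JQ; apply: ideal_mull => //; apply: W_mul => //; exact: top_max.
Qed.

Let sum_QI (b : 'I_d -> A) : (forall j, j != i -> I (b j)) ->
  ideal_mul Q I (\sum_(j < d | j != i) b j * q j).
Proof.
move=> hb; apply: (@ideal_sum _ (ideal_mul Q I)) => // j ji; rewrite mulrC.
by apply: ideal_mul_in; [apply: sub_ideal_span; exists j|exact: hb].
Qed.

(** A relation expressing w x by the q_j, j <> i, with coefficients b_j writes the product with
    coefficients x^(N-2) a b_j, which are shown to lie in I. *)
Let W_top w a : W w -> I (x ^+ n.+1 * a) -> ideal_mul Q I (w * (x ^+ n.+1 * a)).
Proof.
move=> Ww Ia; have := colp_syzygy hA he (x := upd q i x) (i := i) (w := w) sop_x.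
rewrite others_upd upd_same => /(_ Ww) [b [hb mb hbt]].
have -> : w * (x ^+ n.+1 * a) = \sum_(j < d | j != i) (x ^+ n * a * b j) * q j.
  have -> : w * (x ^+ n.+1 * a) = x ^+ n * a * (w * x) by rewrite exprS; ring.
  rewrite hb mulr_sumr; apply: eq_bigr => j ji.
  by rewrite upd_other // mulrA.
apply: sum_QI => j ji y my; have [t mt ht] := top_mul Ia my.
have -> : x ^+ n * a * b j * y =
    x ^+ n * ((a * y - x * t) * b j) + x ^+ n.+1 * (b j * t).
  by rewrite exprS; ring.
apply: (@idealD _ Q) => //.
  by apply: JQ; apply: ideal_mull => //; apply: W_mul => //; exact: mb.
(* b_j t lies in the ideal of x and the q_k with k different from i and j, and x^(N-1) carries x to
   x^N. *)
have [r hr] : addp J x (b j * t).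
  apply: (others_min _ _ (hbt j t ji mt)); first exact: is_ideal_addp.
  move=> k kj; rewrite /upd; case: eqVneq => [_|ki]; first exact: addp_id.
  by apply: addp_sub; exact: others_in.
have -> : x ^+ n.+1 * (b j * t) = x ^+ n.+1 * (b j * t - r * x) + r * x ^+ n.+2.
  by rewrite (exprS x n.+1); ring.
apply: (@idealD _ Q) => //; first by apply: JQ; exact: ideal_mull.
by rewrite QE; exact: addp_gen.
Qed.

(* w w' is the difference of w (w' + x^N) and w x^N, where both w' + x^N and
   x^N = q_i complete J to a system of parameters. *)
Let W_W w w' : W w -> W w' -> ideal_mul Q I (w * w').
Proof.
move=> Ww Ww'; have mw' := W_sub_max Ww'.
set z := w' + x ^+ n.+2.
have mz : m z by apply: idealD => //; rewrite exprS; exact: ideal_mulr.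
have sz : system_of_parameters m (upd q i z).
  (* As w' x lies in J, x^(2N) equals x^N z modulo J. *)
  apply: (sop_upd noethA locA) => //; exists 2%N; rewrite qi -/J expr2.
  have -> : x ^+ n.+2 * x ^+ n.+2 = x ^+ n.+2 * z - x ^+ n.+1 * (w' * x).
    by rewrite /z (exprS x n.+1); ring.
  have ia := is_ideal_addp z iJ.
  by apply: idealB => //; [exact: addp_gen|apply: addp_sub; exact: ideal_mull].
have := colp_syzygy hA he (x := upd q i z) (i := i) (w := w) sz.
rewrite others_upd upd_same => /(_ (W_mul Ww mz)) [b [hb _ hbt]].
have := colp_syzygy hA he (x := q) (i := i) (w := w) sq.
rewrite -/J qi => -[|c [hc _ hct]].
  by apply: W_mul => //; rewrite exprS; exact: ideal_mulr.
have -> : w * w' = \sum_(j < d | j != i) (b j - c j) * q j.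
  have -> : w * w' = w * z - w * x ^+ n.+2 by rewrite /z; ring.
  rewrite hb hc -sumrB; apply: eq_bigr => j ji.
  by rewrite upd_other // mulrBl.
apply: sum_QI => j ji; apply: (@idealB _ I) => //; last first.
  by move=> t mt; apply: others_sub_span; exact: hct.
have Ib : ideal_colon (ideal_span (range (upd q i z))) m (b j).
  by move=> t mt; apply: others_sub_span; exact: hbt.
(* By mI = mQ for the system containing z, the coefficient t_i of z lies in m, so t_i w' is in J and
   t_i z is in J + (x^N) = Q. *)
move=> y my; have [t [mt ->]] := colon_mul_maximal hA he sz Ib my.
apply: (@ideal_sum _ Q) => // k _; rewrite /upd; case: eqVneq => [_|ki].
  rewrite /z mulrDr; apply: (@idealD _ Q) => //; first by apply: JQ; rewrite mulrC; exact: W_mul.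
  by rewrite QE; exact: addp_gen.
by apply: (@ideal_mull _ Q) => //; apply: sub_ideal_span; exists k.
Qed.

Lemma socle_ideal_sqr : ideal_exp I 2 = ideal_mul Q I.
Proof.
have QI : Q `<=` I by move=> a Qa y _; exact: (@ideal_mulr _ Q).
have -> : ideal_exp I 2 = ideal_mul I I.
  rewrite /ideal_exp /=; congr ideal_mul; apply/seteqP; split.
    by apply: ideal_mul_sub => // a b Ia _; exact: (@ideal_mulr _ I).
  by move=> a Ia; rewrite -[a]mulr1; exact: ideal_mul_in.
apply/seteqP; split; last by apply: ideal_mulS.
apply: ideal_mul_sub => // z z' Iz Iz'.
have [a Wa] := I_decomp Iz; have [b Wb] := I_decomp Iz'.
have Ia : I (x ^+ n.+1 * a).
  have -> : x ^+ n.+1 * a = z - (z - x ^+ n.+1 * a) by ring.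
  by apply: (@idealB _ I) => //; exact: W_sub_I.
have Ib : I (x ^+ n.+1 * b).
  have -> : x ^+ n.+1 * b = z' - (z' - x ^+ n.+1 * b) by ring.
  by apply: (@idealB _ I) => //; exact: W_sub_I.
set w := z - _ in Wa; set w' := z' - _ in Wb.
have -> : z * z' = (x ^+ n.+1 * a * (x ^+ n.+1 * b) + w * (x ^+ n.+1 * b)) +
    (w' * (x ^+ n.+1 * a) + w * w') by rewrite /w /w'; ring.
apply: (@idealD _ (ideal_mul Q I)) => //; apply: (@idealD _ (ideal_mul Q I)) => //;
  [exact: top_top|exact: W_top|exact: W_top|exact: W_W].
Qed.

End SocleIdeal.

Theorem mainTheorem4 (A : comNzRingType) (m : set A)
    (hA : buchsbaum_local_ring m)
    (d : nat) (hd : d = krull_dim A)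
    (x : 'I_d -> A) (hx : system_of_parameters m x)
    (n : 'I_d -> nat) (hn : forall i, (1 <= n i)%N)
    (Q : set A) (hQ : Q = ideal_span (range (fun i => x i ^+ n i)))
    (I : set A) (hI : I = ideal_colon Q m)
    (he : 1 < multiplicity m)
    (hn2 : exists i, (2 <= n i)%N) :
  ideal_exp I 2 = ideal_mul Q I.
Proof.
have [noethA locA _ _] := hA.
have [i ni] := hn2; rewrite hI hQ.
apply: (@socle_ideal_sqr _ _ hA he _ _ i (x i) (n i - 2)%N).
- exact: (sop_exp noethA locA).
- exact: (sop_in noethA locA).
- by congr (_ ^+ _); lia.
Qed.
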